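(* Let $k\ge 0$, $m,m'$ be integers with $m\ge 2m'$, $m\geq k(k+1)$, $m'\geq k^2$, and consider the dual pair $(\mathrm{Sp}_{2m}(q),\mathrm{O}^{\epsilon}_{2m'}(q))$ with $\epsilon=+$ if $k$ is even and $\epsilon=-$ if $k$ is odd. Put $l=m-k(k+1)$ and $l'=m'-k^2$, and let $\Omega_{l,l'}$ be the representation of $W_l\times W_{l'}$ given by $$\Omega_{l,l'}=\sum_{r=0}^{\min(l,l')}\ \sum_{(\xi,\zeta)\in\mathscr{P}_2(r)}\ \sum_{\eta,\eta'}\chi_{\xi,\eta}\otimes\chi_{\xi,\eta'},$$ where the third sum is over partitions $\eta$ of $l-|\xi|$ and $\eta'$ of $l'-|\xi|$ such that $\zeta\preceq\eta$ and $\zeta\preceq\eta'$. Let $(\xi',\eta')$ be a bipartition of $l'$, with $\eta'=(\eta'_1,\ldots,\eta'_r)$, and let $\Theta(\xi',\eta')$ be the set of bipartitions $(\xi,\eta)$ of $l$ such that $\chi_{\xi,\eta}\otimes\chi_{\xi',\eta'}$ is an irreducible component of $\Omega_{l,l'}$. Then: 1. There exists a unique minimal representation in $\Theta(\xi',\eta')$; it is given by $(\xi',(l-l')\cup\eta')$. 2. There exists a unique maximal representation in $\Theta(\xi',\eta')$; it is given by $(\xi',(l-l'+\eta'_1+\eta'_2,\eta'_3,\ldots,\eta'_r))$.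
   Context: Partitions $\mu=(\mu_1\ge\mu_2\ge\cdots)$ are identified up to trailing zeros; $|\mu|$ is the sum of the parts; $a\cup\mu$ is the partition obtained by adjoining the part $a$ to $\mu$. For partitions of possibly different integers, $\mu\preceq\mu'$ means $\mu'_{i+1}\le\mu_i\le\mu'_i$ for all $i$. For partitions of the same integer, $\mu\le\mu'$ means $\mu_1+\cdots+\mu_j\le\mu'_1+\cdots+\mu'_j$ for all $j$. $\mathscr{P}_2(n)$ is the set of bipartitions $(\lambda,\mu)$ of $n$ (pairs of partitions with $|\lambda|+|\mu|=n$). $W_n$ is the Weyl group of type $B_n$ (equivalently $C_n$), and $\chi_{\lambda,\mu}$ is its irreducible representation indexed by $(\lambda,\mu)\in\mathscr{P}_2(n)$. The representation $\Omega_{l,l'}$ describes the Howe correspondence between the unipotent Harish-Chandra series of the pair attached to the cuspidal unipotent representation with parameter $k$ of a symplectic group; the condition $m\ge 2m'$ is the stable range condition. The map $\lambda(\cdot,\cdot)$ from bipartitions of $n$ to symplectic partitions of $2n$ (partitions in which each odd part has even multiplicity; they parametrize unipotent classes of $\mathrm{Sp}_{2n}(\overline{\mathbb{F}}_q)$) is defined as follows. (a) Let $\lambda$ be a symplectic partition of $2n$, written with an even number $2j$ of parts (adding a zero if necessary). Put $\lambda^*_i=\lambda_{2j-i+1}+i-1$ for $i=1,\ldots,2j$. Among the $\lambda_i^*$ there are $j$ odd numbers $2\xi^*_1+1<\cdots<2\xi^*_j+1$ and $j$ even numbers $2\eta^*_1<\cdots<2\eta^*_j$. Put $\xi_i=\xi^*_{j-i+1}-(j-i)$,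 $\eta_i=\eta^*_{j-i+1}-(j-i)$. This defines a bipartition $(\xi(\lambda),\eta(\lambda))$ of $n$, and the map $\lambda\mapsto(\xi(\lambda),\eta(\lambda))$ is injective. (b) To a bipartition $(\xi,\eta)$ of $n$, written (adding zeros) so that $\eta$ has $j$ parts and $\xi$ has $j+1$ parts, one associates the $u$-symbol with top row $\xi_{j+1},\xi_j+2,\ldots,\xi_1+2j$ and bottom row $\eta_j+1,\eta_{j-1}+3,\ldots,\eta_1+2j-1$. It is distinguished if $\xi_{j+1}\le\eta_j+1\le\xi_j+2\le\eta_{j-1}+3\le\cdots\le\xi_1+2j$. Two $u$-symbols are similar if they have the same entries with the same multiplicities; each similarity class contains exactly one distinguished $u$-symbol. A bipartition is in the image of the map in (a) if and only if its $u$-symbol is distinguished. (c) For any bipartition $(\xi,\eta)$ of $n$, $\lambda(\xi,\eta)$ is the symplectic partition $\lambda$ such that $(\xi(\lambda),\eta(\lambda))$ is the bipartition whose $u$-symbol is the distinguished one similar to the $u$-symbol of $(\xi,\eta)$. (Via the Springer correspondence, $\chi_{\xi,\eta}$ is attached to the unipotent class parametrized by $\lambda(\xi,\eta)$.) A minimal representation in $\Theta(\xi',\eta')$ is an element $(\xi_{\min},\eta_{\min})\in\Theta(\xi',\eta')$ with $\lambda(\xi_{\min},\eta_{\min})\le\lambda(\xi,\eta)$ for all $(\xi,\eta)\in\Theta(\xi',\eta')$; a maximal representation is an element $(\xi_{\max},\eta_{\max})\in\Theta(\xi',\eta')$ with $\lambda(\xi,\eta)\le\lambda(\xi_{\max},\eta_{\max})$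 for all $(\xi,\eta)\in\Theta(\xi',\eta')$. *)

(* Defs.v *)
From HB Require Import structures.
From mathcomp Require Import all_boot all_order all_algebra.
From mathcomp Require Import all_fingroup all_solvable all_field all_character.

Set Implicit Arguments.
Unset Strict Implicit.
Unset Printing Implicit Defensive.

Import Order.TTheory GRing.Theory Num.Theory.

(* A partition is its weakly decreasing sequence of nonzero parts: the normal
   form for "up to trailing zeros".  The part of 0-based index i is nth 0 s i,
   which vanishes beyond the end. *)
Definition is_partition (s : seq nat) : bool := sorted geq s && (0 \notin s).

Definition is_partition_of (n : nat) (s : seq nat) : bool :=
  is_partition s && (sumn s == n).

Definition strip (s : seq nat) : seq nat := [seq x <- s | x != 0].

Definition adjoin (a : nat) (mu : seq nat) : seq nat :=
  strip (sort geq (a :: mu)).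

Definition prec_part (mu mu' : seq nat) : bool :=
  all (fun i => nth 0 mu' i.+1 <= nth 0 mu i <= nth 0 mu' i)
      (iota 0 (maxn (size mu) (size mu'))).

Definition dominated (mu mu' : seq nat) : Prop :=
  forall j : nat, sumn (take j mu) <= sumn (take j mu').

(* Partitions of n with all parts at most b; f is fuel, f >= n suffices. *)
Fixpoint partitions_rec (f b n : nat) : seq (seq nat) :=
  if n == 0 then [:: [::]] else
  if f is f'.+1 then
    [seq a :: p | a <- iota 1 (minn b n), p <- partitions_rec f' a (n - a)]
  else [::].

Definition partitions (n : nat) : seq (seq nat) := partitions_rec n n n.

Definition bipartition := (seq nat * seq nat)%type.

Definition is_bipartition (n : nat) (b : bipartition) : bool :=
  [&& is_partition b.1, is_partition b.2 & sumn b.1 + sumn b.2 == n].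

Definition bipartitions (n : nat) : seq bipartition :=
  flatten [seq [seq (x, z) | x <- partitions a, z <- partitions (n - a)]
          | a <- iota 0 n.+1].

Lemma partitions_recP f b n s : n <= f ->
  (s \in partitions_rec f b n) =
  is_partition_of n s && all (fun x => x <= b) s.
Proof.
elim: f b n s => [|f IHf] b n s.
  rewrite leqn0 => /eqP-> /=; rewrite inE /is_partition_of /is_partition.
  case: s => [|a p] //=; apply/esym/negP; rewrite inE negb_or.
  by case/andP=> /andP[/andP[_ /andP[a0 _]]]; rewrite addn_eq0 eq_sym (negPf a0).
rewrite /=; case: (posnP n) => [-> _|n_gt0 le_n].
  rewrite inE /is_partition_of /is_partition.
  case: s => [|a p] //=; apply/esym/negP; rewrite inE negb_or.
  by case/andP=> /andP[/andP[_ /andP[a0 _]]]; rewrite addn_eq0 eq_sym (negPf a0).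
have geq_tr : transitive geq by move=> y x z /= yx zy; apply: leq_trans zy yx.
rewrite /is_partition_of /is_partition; apply/allpairsPdep/idP => /=.
  case=> a [p [Ha Hp ->]]; move: Ha; rewrite mem_iota add1n ltnS leq_min.
  case/and3P=> a_gt0 ab an; move: Hp; rewrite IHf; last first.
    by rewrite leq_subLR (leq_trans le_n) // -add1n leq_add2r.
  case/andP=> /andP[/andP[sp p0] /eqP sum_p] pa.
  rewrite /= path_sortedE // sp pa inE negb_or eq_sym -lt0n a_gt0 p0 sum_p.
  rewrite subnKC // eqxx ab /=.
  by apply: sub_all pa => x /leq_trans->.
case: s => [|a p]; first by rewrite /= ltn_eqF.
rewrite /= path_sortedE // inE negb_or eq_sym -lt0n.
case/andP=> /andP[/andP[/andP[pa sp] /andP[a_gt0 p0]] /eqP def_n] /andP[ab _].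
have an : a <= n by rewrite -def_n leq_addr.
exists a, p; split=> //; first by rewrite mem_iota add1n ltnS leq_min a_gt0 ab.
rewrite IHf; last by rewrite leq_subLR (leq_trans le_n) // -add1n leq_add2r.
by rewrite /is_partition_of /is_partition sp p0 -def_n addKn eqxx.
Qed.

Lemma mem_partitions n s : (s \in partitions n) = is_partition_of n s.
Proof.
rewrite partitions_recP // andb_idr // => /andP[_ /eqP<-].
apply/allP=> x; elim: s => //= a s IHs; rewrite inE => /predU1P[-> | /IHs].
  exact: leq_addr.
by move/leq_trans; apply; apply: leq_addl.
Qed.

Lemma partitions_uniq n : uniq (partitions n).
Proof.
suff rec_uniq f b k : uniq (partitions_rec f b k) by apply: rec_uniq.
elim: f b k => [|f IHf] b k /=.
  by case: ifP.
case: ifP => // _; apply: allpairs_uniq_dep => [|a _|[a p] [a' p'] _ _ /= []].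
- exact: iota_uniq.
- exact: IHf.
- by move=> -> ->.
Qed.

Lemma mem_bipartitions n b : (b \in bipartitions n) = is_bipartition n b.
Proof.
case: b => x z; apply/flatten_mapP/idP => [[a] | /and3P[/= px pz /eqP<-]].
  rewrite mem_iota add0n /= ltnS => an /allpairsP[[x1 z1] /= [+ + [-> ->]]].
  rewrite !mem_partitions => /andP[px /eqP sx] /andP[pz /eqP sz].
  by rewrite /is_bipartition /= px pz sx sz subnKC /=.
have sx : sumn x \in iota 0 (sumn x + sumn z).+1 by rewrite mem_iota ltnS leq_addr.
exists (sumn x) => //.
apply/allpairsP; exists (x, z); rewrite !mem_partitions /is_partition_of.
by rewrite px pz addKn !eqxx.
Qed.

(* The Weyl group of type B_n: the signed permutation (s, e) sends the basis
   vector e_i to (-1)^(e i) e_(s i), and, as for {perm T}, x * y is x followed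
   by y. *)
Definition signed_perm (n : nat) : Type :=
  ({perm 'I_n} * {ffun 'I_n -> bool})%type.
HB.instance Definition _ n :=
  Finite.copy (signed_perm n) ({perm 'I_n} * {ffun 'I_n -> bool})%type.

Section SignedPermGroup.

Variable n : nat.
Implicit Types x y z : signed_perm n.

Definition sp_mul x y : signed_perm n :=
  ((x.1 * y.1)%g, [ffun i => x.2 i (+) y.2 (x.1 i)]).
Definition sp_one : signed_perm n := (1%g, [ffun=> false]).
Definition sp_inv x : signed_perm n := (x.1^-1%g, [ffun i => x.2 (x.1^-1%g i)]).

Fact sp_mulA : associative sp_mul.
Proof.
move=> x y z; congr pair => /=; first exact: mulgA.
by apply/ffunP=> i; rewrite !ffunE permM addbA.
Qed.

Fact sp_mul1 : left_id sp_one sp_mul.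
Proof.
move=> [s e]; congr pair => /=; first exact: mul1g.
by apply/ffunP=> i; rewrite !ffunE perm1.
Qed.

Fact sp_mulV : left_inverse sp_one sp_inv sp_mul.
Proof.
move=> x; congr pair => /=; first exact: mulVg.
by apply/ffunP=> i; rewrite !ffunE addbb.
Qed.

HB.instance Definition _ :=
  Finite_isGroup.Build (signed_perm n) sp_mulA sp_mul1 sp_mulV.

End SignedPermGroup.

Notation W n := [set: signed_perm n]%G.

Section LabelCharacters.

Variables (n : nat) (f : 'I_n -> bool * nat).

Definition label_stab : {set signed_perm n} :=
  [set w : signed_perm n | [forall i, f (w.1 i) == f i]].

Fact label_stab_group_set : group_set label_stab.
Proof.
apply/group_setP; split=> [|x y]; first by rewrite inE; apply/forallP=> i; rewrite perm1.
rewrite !inE => /forallP fx /forallP fy; apply/forallP=> i /=.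
by rewrite permM (eqP (fy _)) fx.
Qed.
Canonical label_stab_group := Group label_stab_group_set.

(* The sign changes at the indices whose label has first component true
   contribute their signs; if tw holds, so does the underlying permutation. *)
Definition label_sign (tw : bool) (w : signed_perm n) : algC :=
  ((-1) ^+ (tw && odd_perm w.1) * \prod_(i | (f i).1) (-1) ^+ w.2 i)%R.

Lemma label_signM tw : {in label_stab &, {morph label_sign tw :
  x y / (x * y)%g >-> (x * y)%R}}.
Proof.
move=> x y; rewrite !inE => /forallP fx _.
rewrite /label_sign mulrACA -signr_addb; congr (_ * _)%R.
  by rewrite /= odd_permM; case: tw.
rewrite [X in (_ * X)%R](reindex_inj (@perm_inj _ x.1)) /=.
rewrite [X in (_ * X)%R](eq_bigl (fun i => (f i).1)); last first.
  by move=> i; rewrite (eqP (fx i)).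
rewrite -big_split /=; apply: eq_bigr => i _.
by rewrite ffunE signr_addb.
Qed.

Fact label_char_subproof tw :
  is_class_fun <<label_stab>>%g
    [ffun w => (label_sign tw w *+ (w \in label_stab))%R].
Proof.
rewrite genGid; apply: intro_class_fun => [x y Hx Hy | x /negPf-> //].
rewrite (groupJ Hx Hy) Hx conjgE; congr (_ *+ _)%R.
rewrite !label_signM ?groupV ?groupM // mulrCA -label_signM ?groupV //.
have sign1 : label_sign tw 1%g = 1%R.
  rewrite /label_sign /= odd_perm1 andbF expr0 mul1r big1 // => i _.
  by rewrite ffunE.
by rewrite mulVg sign1 mulr1.
Qed.

Definition label_char (tw : bool) : 'CF(label_stab) :=
  Cfun 1 (label_char_subproof tw).

End LabelCharacters.

(* The n boxes (c, (i, j)) of the pair of Young diagrams of (la, mu), where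
   c = false for la and c = true for mu, i is the row and j the column. *)
Definition boxes (la mu : seq nat) : seq (bool * (nat * nat)) :=
  [seq (false, (i, j)) | i <- iota 0 (size la), j <- iota 0 (nth 0 la i)] ++
  [seq (true, (i, j)) | i <- iota 0 (size mu), j <- iota 0 (nth 0 mu i)].

Definition box n la mu (i : 'I_n) := nth (false, (0, 0)) (boxes la mu) i.

Definition row_label n la mu (i : 'I_n) : bool * nat :=
  ((box la mu i).1, (box la mu i).2.1).
Definition col_label n la mu (i : 'I_n) : bool * nat :=
  ((box la mu i).1, (box la mu i).2.2).

(* chi n la mu is the irreducible character of W_n usually labelled by the
   bipartition (la, mu) of n, obtained as for the symmetric group: it is the
   only common constituent, with multiplicity one, of the two characters
   induced from the row stabiliser (trivial on permutations) and from the
   column stabiliser (sign on permutations), where on both subgroups a sign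
   change counts -1 exactly at the boxes of mu.  Thus ((n), empty) labels the
   trivial character and (empty, (1^n)) the sign character.  The default 0 is
   irrelevant for bipartitions of n. *)
Definition chi_idx (n : nat) (la mu : seq nat) : Iirr (W n) :=
  odflt 0%R [pick t |
    (t \in irr_constt ('Ind[W n] (label_char (@row_label n la mu) false))%R) &&
    (t \in irr_constt ('Ind[W n] (label_char (@col_label n la mu) true))%R)].

Definition chi (n : nat) (la mu : seq nat) : 'CF(W n) :=
  ('chi_(chi_idx n la mu))%R.

Section OuterTensor.

Variables gT rT : finGroupType.

Fact cfOuter_subproof (G : {group gT}) (H : {group rT})
    (phi : 'CF(G)) (psi : 'CF(H)) :
  is_class_fun <<setX G H>>%g [ffun u => (phi u.1 * psi u.2)%R].
Proof.
rewrite genGid; apply: intro_class_fun => [[x1 x2] [y1 y2] _ | [x1 x2]].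
  by case/setXP=> Gy Hy /=; rewrite !cfunJ.
rewrite inE negb_and /= => /orP[] notGH; first by rewrite cfun0 ?mul0r.
by rewrite [X in (_ * X)%R]cfun0 ?mulr0.
Qed.

Definition cfOuter (G : {group gT}) (H : {group rT})
    (phi : 'CF(G)) (psi : 'CF(H)) : 'CF(setX G H) :=
  Cfun 0 (cfOuter_subproof phi psi).

End OuterTensor.

Definition Omega (l l' : nat) : 'CF(setX (W l) (W l')) :=
  (\sum_(r < (minn l l').+1) \sum_(xz <- bipartitions r)
   \sum_(eta <- partitions (l - sumn xz.1) | prec_part xz.2 eta)
   \sum_(eta' <- partitions (l' - sumn xz.1) | prec_part xz.2 eta')
     cfOuter (chi l xz.1 eta) (chi l' xz.1 eta'))%R.

Definition irr_component (gT : finGroupType) (G : {group gT})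
    (phi psi : 'CF(G)) : Prop :=
  exists2 t : Iirr G, phi = ('chi_t)%R & t \in irr_constt psi.

Definition Theta (l l' : nat) (b' b : bipartition) : Prop :=
  is_bipartition l b /\
  irr_component (cfOuter (chi l b.1 b.2) (chi l' b'.1 b'.2)) (Omega l l').

Definition symplectic (la : seq nat) : bool :=
  all (fun a => odd a ==> ~~ odd (count_mem a la)) la.

(* The increasing sequence i |-> la_(2j-i+1) + i - 1 for the smallest j such
   that la has at most 2j parts (indices are shifted to start at 0). *)
Definition star (la : seq nat) : seq nat :=
  let jj := (uphalf (size la)).*2 in
  mkseq (fun i => nth 0 la (jj - i.+1) + i) jj.

Definition unshift (s : seq nat) : seq nat :=
  strip (rev (mkseq (fun i => nth 0 s i - i) (size s))).

Definition xi_eta (la : seq nat) : bipartition :=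
  (unshift [seq x./2 | x <- star la & odd x],
   unshift [seq x./2 | x <- star la & ~~ odd x]).

(* u-symbol (top row, bottom row), with j + 1 parts for b.1 and j for b.2. *)
Definition u_symbol (j : nat) (b : bipartition) : seq nat * seq nat :=
  (mkseq (fun i => nth 0 b.1 (j - i) + i.*2) j.+1,
   mkseq (fun i => nth 0 b.2 (j - i.+1) + i.*2.+1) j).

Definition distinguished (S : seq nat * seq nat) : bool :=
  all (fun i => nth 0 S.1 i <= nth 0 S.2 i <= nth 0 S.1 i.+1)
      (iota 0 (size S.2)).

Definition similar (S T : seq nat * seq nat) : bool :=
  perm_eq (S.1 ++ S.2) (T.1 ++ T.2).

(* Every bipartition of n fits in u-symbols with j = n; passing from j to
   j + 1 adds 2 to all entries and adjoins 0 on top and 1 at the bottom, hence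
   affects neither similarity nor distinguishedness.  The filtered list has
   exactly one element, so head's default plays no role. *)
Definition lambda (b : bipartition) : seq nat :=
  let n := sumn b.1 + sumn b.2 in
  head [::] [seq la <- partitions n.*2 | [&& symplectic la,
    distinguished (u_symbol n (xi_eta la)) &
    similar (u_symbol n (xi_eta la)) (u_symbol n b)]].

Definition minimal_rep (l l' : nat) (b' b : bipartition) : Prop :=
  Theta l l' b' b /\
  forall c, Theta l l' b' c -> dominated (lambda b) (lambda c).

Definition maximal_rep (l l' : nat) (b' b : bipartition) : Prop :=
  Theta l l' b' b /\
  forall c, Theta l l' b' c -> dominated (lambda c) (lambda b).

(* Main.v *)
Require Import Defs.
From mathcomp Require Import all_boot all_order all_algebra.
From mathcomp Require Import all_fingroup all_field all_character.
From mathcomp Require Import zify.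

(** The irreducible characters labelled by distinct bipartitions are distinct
    ([chi_inj]), so the constituents of Omega can be read off from its labels:
    Theta (xi', eta') consists of the bipartitions (xi', eta) of l for which some
    zeta interlaces both eta and eta' ([Theta_iff]).  For such an eta the two
    interlacings give, with parts indexed from 0,
    eta'_(i+1) <= eta_i and eta_(i+1) <= eta'_i for all i.
    The totals being fixed, bounding all parts but the first from above bounds the
    partial sums from below and conversely.  Hence the second components are
    extremal in the dominance order when their parts beyond the first equal
    eta'_0, eta'_1, ... (minimum) or eta'_2, eta'_3, ... (maximum), and these two
    partitions do interlace with a common zeta, namely eta' itself and eta' without
    its first part.  The stable range gives l - l' >= l' >= eta'_0, which makes
    l - l' followed by eta' a partition.

    It remains to see that, for a fixed first component, lambda is injective
    ([lambda_inj]) and increasing ([lambda_mono]) for the dominance order.  Let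
    d_0 >= ... >= d_(2n) be the entries of the u-symbol of a bipartition of n and
    y_i = d_i - (2n - i).  The partition lambda is obtained from y by replacing an
    ascent y_i, y_(i+1) = y_i + 1 by two odd parts 2 y_i + 1 and doubling every
    other entry ([lambda_spec]).  So a partial sum of lambda is twice that of y,
    plus one when the cut falls inside an ascent, and dominance of lambda follows
    from dominance of the sorted entries d, an ascent being accounted for by the
    neighbouring partial sums ([pair_cut_le]).  Dominance of sorted entries amounts
    to inequalities between the sums of z - t, truncated at 0, over all entries z,
    for every threshold t ([threshold_le], [prefix_sum_le]).  These sums are
    additive over the two rows; the top row is common, and the bottom rows differ
    from eta by one and the same staircase.

    For the characters, the scalar product of the characters induced from the row
    stabiliser of b and from the column stabiliser of b' is nonzero exactly when
    some permutation of the boxes preserves the component and sends no two boxes of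
    one row of b to one column of b' ([cfdot_label]).  For b = b' the identity is
    such a permutation; in general its existence forces b to be dominated by b'
    componentwise ([dominated_of_labels]).  Two bipartitions with the same character
    thus dominate each other. *)

Set Implicit Arguments.
Unset Strict Implicit.
Unset Printing Implicit Defensive.

Import Order.TTheory GRing.Theory Num.Theory.

(** * Partitions, dominance and interlacing *)

Lemma sumn_take_nth s k : sumn (take k s) = \sum_(i < k) nth 0 s i.
Proof.
elim: s k => [|x s IHs] [|k] //=; rewrite ?big_ord0 //.
  by rewrite big1 // => i _; rewrite nth_nil.
by rewrite big_ord_recl IHs.
Qed.

Lemma sumn_nth s k : size s <= k -> sumn s = \sum_(i < k) nth 0 s i.
Proof. by move=> sk; rewrite -sumn_take_nth take_oversize. Qed.

Lemma sorted_geq_nth s : sorted geq s ->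
  forall i j, i <= j -> nth 0 s j <= nth 0 s i.
Proof.
move=> ss i j ij; case: (ltnP j (size s)) => [js | sj]; last by rewrite nth_default.
have geq_tr : transitive geq by move=> b a c ba cb; apply: leq_trans cb ba.
apply: (sorted_leq_nth geq_tr (fun x => leqnn x) 0 ss) => //.
exact: leq_ltn_trans ij js.
Qed.

Lemma is_partition_eq s t : is_partition s -> is_partition t ->
  (forall i, nth 0 s i = nth 0 t i) -> s = t.
Proof.
move=> /andP[_ s0] /andP[_ t0] st.
have le_size u v : 0 \notin u -> (forall i, nth 0 u i = nth 0 v i) ->
    size u <= size v.
  move=> u0 uv; rewrite leqNgt; apply: contra u0 => vu.
  by rewrite -(nth_default 0 (leqnn (size v))) -uv mem_nth.
apply: (@eq_from_nth _ 0) => [|i _]; last exact: st.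
by apply/eqP; rewrite eqn_leq !le_size.
Qed.

Lemma dominated_anti s t : is_partition s -> is_partition t ->
  dominated s t -> dominated t s -> s = t.
Proof.
move=> ps pt st ts; apply: is_partition_eq => // i.
have eq_sum k : \sum_(j < k) nth 0 s j = \sum_(j < k) nth 0 t j.
  by apply/eqP; rewrite -!sumn_take_nth eqn_leq st ts.
by have := eq_sum i.+1; rewrite !big_ord_recr /= eq_sum => /addnI.
Qed.

Lemma sumn_strip s : sumn (strip s) = sumn s.
Proof. by elim: s => //= -[|x] s /= ->. Qed.

Lemma nth_strip s i : sorted geq s -> nth 0 (strip s) i = nth 0 s i.
Proof.
elim: s i => //= x s IHs i ss; have /IHs {}IHs := path_sorted ss.
case: x ss => [|x] ss /=; last by case: i => //=.
have s0 k : nth 0 s k = 0.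
  by have := sorted_geq_nth (ss : sorted geq (0 :: s)) (leq0n k.+1) => /=; lia.
by rewrite IHs s0; case: i => //= i; rewrite s0.
Qed.

Lemma is_partition_strip s : sorted geq s -> is_partition (strip s).
Proof.
move=> ss; rewrite /is_partition mem_filter eqxx andbT.
by apply: sorted_filter ss => b a c ba cb; apply: leq_trans cb ba.
Qed.

Lemma sorted_geq_of_nth s :
  (forall i, nth 0 s i.+1 <= nth 0 s i) -> sorted geq s.
Proof. by move=> s_le; apply/(sortedP 0) => i _; apply: s_le. Qed.

Lemma size_le_sumn s : 0 \notin s -> size s <= sumn s.
Proof.
elim: s => //= x s IHs; rewrite inE negb_or eq_sym -lt0n => /andP[x0 /IHs].
by lia.
Qed.

Lemma sumn_le_nth s t : (forall i, nth 0 s i <= nth 0 t i) -> sumn s <= sumn t.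
Proof.
move=> le_st; rewrite (sumn_nth (leq_maxl (size s) (size t))).
by rewrite (sumn_nth (leq_maxr (size s) (size t))); apply: leq_sum.
Qed.

(** The totals being equal, a smaller tail leaves more to every partial sum. *)
Lemma dominated_of_tail s t : sumn s = sumn t ->
  (forall i, nth 0 t i.+1 <= nth 0 s i.+1) -> dominated s t.
Proof.
move=> eq_sum tail [|j]; first by rewrite !take0.
have : sumn (drop j.+1 t) <= sumn (drop j.+1 s).
  by apply: sumn_le_nth => i; rewrite !nth_drop addSn.
move: eq_sum; rewrite -{1}(cat_take_drop j.+1 s) -{1}(cat_take_drop j.+1 t).
by rewrite !sumn_cat; lia.
Qed.

Lemma prec_partP mu mu' :
  reflect (forall i, nth 0 mu' i.+1 <= nth 0 mu i <= nth 0 mu' i)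
          (prec_part mu mu').
Proof.
apply: (iffP allP) => [mu_mu' i | mu_mu' i _]; last exact: mu_mu'.
have [i_lt | le_i] := ltnP i (maxn (size mu) (size mu')).
  by apply: mu_mu'; rewrite mem_iota.
by rewrite !nth_default // ?(leq_trans _ (leqW le_i)) ?(leq_trans _ le_i)
  ?leq_maxl ?leq_maxr.
Qed.

Lemma prec_part_sumn mu mu' : prec_part mu mu' -> sumn mu <= sumn mu'.
Proof.
by move/prec_partP=> le_mu; apply: sumn_le_nth => i; have /andP[] := le_mu i.
Qed.

(** * Dominance by thresholds *)

(** The sum of the f i - t, truncated at 0, is attained on an initial segment of
    the decreasing sequence f, where it is a partial sum minus a multiple of t.
    Contrary to partial sums of sorted sequences, such truncated sums are additive
    over unions of multisets, which is what allows a common part to be cancelled. *)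
Lemma threshold_le N (f g : nat -> nat) :
    (forall i j, i <= j < N -> f j <= f i) ->
    (forall k, k <= N -> \sum_(i < k) f i <= \sum_(i < k) g i) ->
  forall t, \sum_(i < N) (f i - t) <= \sum_(i < N) (g i - t).
Proof.
move=> fN fg t; elim: N fN fg => [|N IHN] fN fg; first by rewrite !big_ord0.
case: (leqP t (f N)) => [tf | ft]; last first.
  rewrite !big_ord_recr /= (eqP (ltnW ft : f N - t == 0)) addn0.
  apply: leq_trans (leq_addr _ _); apply: IHN => [i j /andP[ij jN]|k kN].
    by apply: fN; rewrite ij ltnS ltnW.
  by apply: fg; rewrite ltnW.
rewrite -(leq_add2r (\sum_(i < N.+1) t)) -!big_split /=.
rewrite (eq_bigr (fun i : 'I_N.+1 => f i)); last first.
  by move=> i _; rewrite subnK // (leq_trans tf) // fN // leq_ord /=.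
apply: leq_trans (fg _ (leqnn _)) _; apply: leq_sum => i _; lia.
Qed.

(** At the threshold t equal to the last value of an initial segment of g, the
    truncated sum of g is exactly the partial sum of g minus a multiple of t, while
    for f it is at least that. *)
Lemma prefix_sum_le N (f g : nat -> nat) :
    (forall i j, i <= j < N -> g j <= g i) ->
    (forall t, \sum_(i < N) (f i - t) <= \sum_(i < N) (g i - t)) ->
  forall k, k <= N -> \sum_(i < k) f i <= \sum_(i < k) g i.
Proof.
move=> gN fg [|k] kN; first by rewrite !big_ord0.
pose t := g k.
have fgt := fg t.
have gE : \sum_(i < k.+1) g i = \sum_(i < k.+1) (g i - t) + \sum_(i < k.+1) t.
  rewrite -big_split /=; apply: eq_bigr => i _; rewrite subnK // gN //.
  by rewrite leq_ord.
have fE : \sum_(i < k.+1) f i <= \sum_(i < k.+1) (f i - t) + \sum_(i < k.+1) t.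
  rewrite -big_split /=; apply: leq_sum => i _; lia.
have fle : \sum_(i < k.+1) (f i - t) <= \sum_(i < N) (f i - t).
  rewrite -!(big_mkord xpredT (fun i => f i - t)).
  by rewrite (@big_cat_nat _ _ _ k.+1 0 N) //= leq_addr.
have gle : \sum_(i < N) (g i - t) = \sum_(i < k.+1) (g i - t).
  rewrite -!(big_mkord xpredT (fun i => g i - t)) (@big_cat_nat _ _ _ k.+1) //=.
  rewrite [X in _ + X]big_nat_cond [X in _ + X]big1 ?addn0 //.
  by move=> i /andP[/andP[ki iN] _]; apply/eqP/gN; rewrite (ltnW ki).
lia.
Qed.

(** * Halving a symplectic partition *)

(** In a weakly decreasing list equal parts are adjacent, so that even
    multiplicity of the odd parts means that these can be read off in pairs. *)
Fixpoint paired (s : seq nat) : bool :=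
  if s is x :: s1 then
    if odd x then (if s1 is y :: s2 then (x == y) && paired s2 else false)
    else paired s1
  else true.

Lemma paired_ind (P : seq nat -> Prop) :
    P [::] ->
    (forall x s, ~~ odd x -> paired s -> P s -> P (x :: s)) ->
    (forall x s, odd x -> paired s -> P s -> P [:: x, x & s]) ->
  forall s, paired s -> P s.
Proof.
move=> P0 P1 P2 s; have [m] := ubnP (size s).
elim: m s => // m IHm [|x s] //=; rewrite ltnS.
case: (boolP (odd x)) => [odd_x | even_x] sm.
  case: s sm => // y s sm /andP[/eqP <- ps].
  by apply: P2 => //; apply: IHm => //; apply: leq_trans sm; rewrite ltnS leqW.
by move=> ps; apply: P1 => //; apply: IHm.
Qed.

Lemma symplectic_paired s : sorted geq s -> symplectic s = paired s.
Proof.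
have symplecticP t : reflect (forall a, odd a -> ~~ odd (count_mem a t))
    (symplectic t).
  apply: (iffP allP) => [t_odd a odd_a | t_odd a _]; last exact/implyP/t_odd.
  have [/t_odd|] := boolP (a \in t); first by rewrite odd_a.
  by move/count_memPn->.
have [m] := ubnP (size s); elim: m s => // m IHm [|x s] // sm ss /=.
case: (boolP (odd x)) => odd_x; last first.
  rewrite -IHm //; last exact: path_sorted ss.
  apply/symplecticP/symplecticP => s_odd a odd_a; have := s_odd a odd_a => /=.
    by case: eqP => // ax; rewrite -ax (negPf odd_x) in odd_a.
  by case: eqP => // ax; rewrite -ax (negPf odd_x) in odd_a.
case: s sm ss => [|y s] sm ss.
  by apply/symplecticP => /(_ x odd_x) /=; rewrite eqxx.
have /= /andP[yx ss1] := ss.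
case: eqP ss yx => [<- | /eqP xy] ss yx; last first.
  apply/symplecticP => /(_ x odd_x) /=; rewrite eqxx eq_sym (negPf xy).
  suff /count_memPn-> : x \notin s by [].
  apply/negP => /(nthP 0)[i _ ix].
  have := sorted_geq_nth (ss1 : sorted geq (y :: s)) (leq0n i.+1).
  by rewrite /= ix; lia.
rewrite -IHm //; first last.
- exact: path_sorted ss1.
- by move: sm => /=; lia.
apply/symplecticP/symplecticP => s_odd a odd_a; have := s_odd a odd_a => /=.
  by rewrite addnA oddD addnn odd_double.
by rewrite addnA oddD addnn odd_double.
Qed.

(** A pair of odd parts 2a + 1 is halved to a, a + 1, in this increasing order:
    the rounding makes the alternate entries of the result the two components of
    the bipartition attached to s. *)
Fixpoint halves (s : seq nat) : seq nat :=
  if s is x :: s1 then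
    if odd x then
      (if s1 is _ :: s2 then [:: x./2, x./2.+1 & halves s2] else [:: x./2])
    else x./2 :: halves s1
  else [::].

(** An ascent in a list of halves can only come from a pair of odd parts. *)
Fixpoint doubles (y : seq nat) : seq nat :=
  if y is a :: y1 then
    if y1 is b :: y2 then
      if a < b then [:: a.*2.+1, a.*2.+1 & doubles y2]
      else a.*2 :: doubles y1
    else [:: a.*2]
  else [::].

Lemma size_halves s : paired s -> size (halves s) = size s.
Proof.
by elim/paired_ind => //= x {}s odd_x _ /= IHs;
  rewrite ?(negPf odd_x) ?odd_x /= IHs.
Qed.

Lemma nth_halves_head s :
  nth 0 (halves s) 0 = (head 0 s)./2.
Proof. by case: s => //= x [|y s]; case: ifP. Qed.

Lemma nth_halves_behead s : paired s -> sorted geq s ->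
  nth 0 (halves s) 1 <= uphalf (head 0 s).
Proof.
case: s => //= x s; case: ifP => odd_x.
  by case: s => //= y s _ _; rewrite uphalf_half odd_x.
move=> _ /= xs; rewrite nth_halves_head.
by case: s xs => //= y s /andP[yx _]; rewrite uphalf_half odd_x half_leq.
Qed.

(** On halves s, for s symplectic, this says that a cut after q entries separates
    the two members of a pair of odd parts. *)
Definition pair_cut (y : seq nat) (q : nat) : bool :=
  (0 < q) && (nth 0 y q.-1 < nth 0 y q).

(** The conditions under which y_i + (2n - i) is weakly decreasing and drops by at
    least 2 in every two steps, as the sorted entries of a u-symbol do. *)
Definition near_sorted (y : seq nat) : Prop :=
  forall i, nth 0 y i.+1 <= (nth 0 y i).+1 /\ nth 0 y i.+2 <= nth 0 y i.

Lemma sum_nth_cons x s q :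
  \sum_(i < q.+1) nth 0 (x :: s) i = x + \sum_(i < q) nth 0 s i.
Proof. by rewrite big_ord_recl. Qed.

(** Rounding only matters inside a pair of odd parts, whose first member has been
    rounded down and whose second up; elsewhere the halves decrease because s
    does, so that the ascents are exactly the pairs. *)
Lemma halves_sums s : paired s -> sorted geq s ->
  near_sorted (halves s) /\
  forall q, \sum_(i < q) nth 0 s i
            = (\sum_(i < q) nth 0 (halves s) i).*2 + pair_cut (halves s) q.
Proof.
elim/paired_ind => [|x {}s even_x ps IHs xs|x {}s odd_x ps IHs xxs].
- move=> _; split=> [i|q]; first by rewrite !nth_nil.
  by rewrite !big1 ?/pair_cut ?nth_nil ?ltnn ?andbF // => i; rewrite nth_nil.
- have ss := path_sorted xs; have [near sums] := IHs ss.
  have := nth_halves_head s; have := nth_halves_behead ps ss.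
  have hx : head 0 s <= x by case: (s) xs => //= y t /andP[].
  set y := halves s in near sums *; move=> y1 y0 /=; rewrite (negPf even_x) -/y.
  split=> [[|i] /=|[|[|q]]]; [lia|exact: near|by rewrite !big_ord0| |].
    by rewrite !sum_nth_cons !big_ord0 /pair_cut /=; lia.
  by rewrite !sum_nth_cons sums /pair_cut /=; lia.
- have ss := path_sorted (path_sorted xxs); have [near sums] := IHs ss.
  have := nth_halves_head s; have := nth_halves_behead ps ss.
  have hx : head 0 s <= x by case: (s) xxs => //= y t /and3P[].
  set y := halves s in near sums *; move=> y1 y0 /=; rewrite odd_x -/y.
  split=> [[|[|i]] /=|[|[|[|q]]]];
    [lia|lia|exact: near|by rewrite !big_ord0| | |].
  + by rewrite !sum_nth_cons !big_ord0 /pair_cut /=; lia.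
  + by rewrite !sum_nth_cons !big_ord0 /pair_cut /=; lia.
  by rewrite !sum_nth_cons sums /pair_cut /=; lia.
Qed.

Lemma near_sorted_behead x y : near_sorted (x :: y) -> near_sorted y.
Proof. by move=> near i; apply: (near i.+1). Qed.

Lemma head_doubles y :
  head 0 (doubles y) = (nth 0 y 0).*2 + (nth 0 y 0 < nth 0 y 1).
Proof. by case: y => [|a [|b y]] /=; [|lia|case: ifP => /=; lia]. Qed.

(** The bound on entries two apart is what makes the result decrease again: the
    entry after an ascent a, a + 1 is at most a, and the ascent that it may start
    gives two parts that are at most 2a + 1. *)
Lemma doublesP y : near_sorted y ->
  [/\ paired (doubles y), sorted geq (doubles y) & halves (doubles y) = y].
Proof.
have [m] := ubnP (size y); elim: m y => // m IHm [|a [|b y]] // ym near.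
  by rewrite /= odd_double doubleK.
have [/= near1 near2] := near 0.
have path_head x s : sorted geq s -> head 0 s <= x -> path geq x s.
  by case: s => //= z s -> ->.
have [ab | ba] := ltnP a b.
  have nearb := near_sorted_behead near.
  have [/= nearb1 nearb2] := nearb 0.
  have [|p s h] := IHm y _ (near_sorted_behead nearb).
    by move: ym => /=; lia.
  rewrite /= odd_double /= eqxx p h uphalf_double leqnn.
  split=> //; last by congr [:: _, _ & _]; lia.
  by apply: path_head => //; rewrite head_doubles; lia.
have [|p s h] := IHm (b :: y) _ (near_sorted_behead near).
  by move: ym => /=; lia.
rewrite (_ : paired _ = paired (doubles (b :: y))) /= ?odd_double //=.
rewrite -/(doubles (b :: y)) in p s h *; split; rewrite ?h ?doubleK //.
apply: path_head => //; rewrite head_doubles /=; lia.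
Qed.

(** * The bipartition of a symplectic partition *)

Lemma mkseq_cons T (f : nat -> T) m :
  mkseq f m.+1 = f 0 :: mkseq (fun i => f i.+1) m.
Proof. by rewrite /mkseq /= -[1]/(1 + 0) iotaDl -map_comp. Qed.

Fixpoint evens (s : seq nat) : seq nat :=
  if s is x :: s1 then x :: (if s1 is _ :: s2 then evens s2 else [::])
  else [::].

Definition odds (s : seq nat) : seq nat := evens (behead s).

Lemma nth_evens s i : nth 0 (evens s) i = nth 0 s i.*2.
Proof.
have [m] := ubnP (size s).
elim: m s i => // m IHm [|x [|y s]] [|i] //= sm; rewrite ?nth_nil //.
by rewrite IHm //; lia.
Qed.

Lemma nth_odds s i : nth 0 (odds s) i = nth 0 s i.*2.+1.
Proof. by rewrite nth_evens nth_behead. Qed.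

(** The sequence [star la] for an arbitrary number N of parts, zeros included. *)
Definition star_at (N : nat) (la : seq nat) : seq nat :=
  mkseq (fun i => nth 0 la (N - i.+1) + i) N.

(** The entries of [star_at] in decreasing order, in a form suited to induction. *)
Fixpoint add_staircase (s : seq nat) : seq nat :=
  if s is x :: s1 then x + size s1 :: add_staircase s1 else [::].

Definition half_filter (a : pred nat) (s : seq nat) : seq nat :=
  [seq x./2 | x <- s & a x].

Lemma half_filter_cons a x s :
  half_filter a (x :: s) =
  if a x then x./2 :: half_filter a s else half_filter a s.
Proof. by rewrite /half_filter /=; case: ifP. Qed.

Lemma star_atS N la : size la <= N ->
  star_at N.+1 la = 0 :: map S (star_at N la).
Proof.
move=> laN; rewrite /star_at mkseq_cons subn1 nth_default // /mkseq -map_comp.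
by congr (_ :: _); apply: eq_map => i /=; rewrite addnS subSS.
Qed.

Lemma unshift_rcons s x : unshift (rcons s x) = strip [:: x - size s] ++ unshift s.
Proof.
rewrite /unshift size_rcons mkseqS rev_rcons nth_rcons ltnn eqxx -cat1s.
rewrite /strip filter_cat; congr (_ ++ filter _ (rev _)).
apply/eq_in_map => i; rewrite mem_iota add0n /= => si.
by rewrite nth_rcons si.
Qed.

Lemma unshift_pad s : unshift (0 :: map S s) = unshift s.
Proof.
rewrite /unshift /= size_map mkseq_cons rev_cons -cats1 /strip filter_cat cats0.
congr (filter _ (rev _)); apply/eq_in_map => i; rewrite mem_iota add0n /= => si.
by rewrite (nth_map 0).
Qed.

(** Two additional zero parts put a 0 in front of each of the two sequences of
    halves and raise their other entries by 1, which [unshift] undoes; therefore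
    any even number of parts gives the same bipartition. *)
Lemma xi_eta_pad n la : size la <= n.*2 ->
  xi_eta la = (unshift (half_filter odd (star_at n.*2 la)),
               unshift (half_filter (predC odd) (star_at n.*2 la))).
Proof.
have shift a s : (forall x, a x.+2 = a x) ->
    half_filter a (map S (map S s)) = map S (half_filter a s).
  move=> a2; rewrite /half_filter; elim: s => //= x s IHs.
  by rewrite a2; case: ifP => _ //=; rewrite IHs.
have la_uphalf : size la <= (uphalf (size la)).*2 by lia.
elim: n => [|n IHn] la_n; first by case: la la_n {la_uphalf}.
have [la_le | n_lt] := leqP (size la) n.*2; last first.
  suff -> : n.+1 = uphalf (size la) by [].
  by lia.
rewrite IHn // doubleS !star_atS // ?(leq_trans la_le) //=.
rewrite !half_filter_cons /= !shift ?unshift_pad // => x /=; by rewrite !negbK.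
Qed.

Lemma size_staircase s : size (add_staircase s) = size s.
Proof. by elim: s => //= x s ->. Qed.

Lemma nth_staircase s i :
  i < size s -> nth 0 (add_staircase s) i = nth 0 s i + (size s - i.+1).
Proof.
elim: s i => // x s IHs [|i] /=; first by rewrite subn1.
by rewrite ltnS subSS => /IHs.
Qed.

Lemma star_at_staircase s : star_at (size s) s = rev (add_staircase s).
Proof.
apply: (@eq_from_nth _ 0); first by rewrite size_mkseq size_rev size_staircase.
move=> i; rewrite size_mkseq => si.
rewrite nth_mkseq // nth_rev ?size_staircase // nth_staircase; last by lia.
by congr (_ + _); lia.
Qed.

Lemma half_filter_cat a s t :
  half_filter a (s ++ t) = half_filter a s ++ half_filter a t.
Proof. by rewrite /half_filter filter_cat map_cat. Qed.

Lemma half_filter_rev a s : half_filter a (rev s) = rev (half_filter a s).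
Proof. by rewrite /half_filter filter_rev map_rev. Qed.

(** A pair of odd parts x with k parts after it contributes x + k + 1 and x + k.
    Its doubled halves x - 1 and x + 1 contribute x + k and x + k + 1: the same
    numbers in the opposite order.  As their parities differ, a selection by parity
    does not see the exchange. *)
Lemma filter_staircase_halves a s : a = odd \/ a = predC odd -> paired s ->
  filter a (add_staircase s) = filter a (add_staircase (map double (halves s))).
Proof.
move=> aE; elim/paired_ind => //= x {}s.
  move=> even_x ps IHs; rewrite (negPf even_x) /= size_map size_halves // IHs.
  by rewrite (_ : x./2.*2 = x) //; lia.
move=> odd_x ps IHs; rewrite odd_x /= size_map size_halves // IHs.
have -> : x./2.*2 + (size s).+1 = x + size s by lia.
have -> : x./2.+1.*2 + size s = x + (size s).+1 by lia.
case: aE => -> /=; rewrite addnS /= ?negbK;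
  by case: (odd (x + size s)).
Qed.

(** When all parts are even, the parity of an entry is that of its distance to the
    end, so that selecting by parity selects every other position. *)
Lemma unshift_staircase_double y : ~~ odd (size y) ->
  let s := rev (add_staircase (map double y)) in
  [/\ unshift (half_filter odd s) = strip (evens y),
      unshift (half_filter (predC odd) s) = strip (odds y),
      size (half_filter odd s) = (size y)./2 &
      size (half_filter (predC odd) s) = (size y)./2].
Proof.
have [m] := ubnP (size y); elim: m y => // m IHm [|x [|z y]] //= ym.
rewrite !negbK => even_y; have [||IHo IHe So Se] := IHm y; rewrite ?negbK //.
  by lia.
move: even_y IHo IHe So Se => /=; rewrite size_map.
set s := rev _ => even_y IHo IHe So Se; rewrite 2!rev_cons -/s -!cats1.
rewrite !half_filter_cat /half_filter /= !oddD !odd_double /= (negPf even_y) /=.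
rewrite -/(half_filter odd s) -/(half_filter (predC odd) s) !cats0 !cats1.
rewrite !unshift_rcons !size_rcons IHo IHe So Se.
have -> : (x.*2 + (size y).+1)./2 - (size y)./2 = x by lia.
have -> : (z.*2 + size y)./2 - (size y)./2 = z by lia.
by rewrite /strip /=; split=> //; case: ifP; case: (y).
Qed.

Lemma paired_pad s k : paired s -> paired (s ++ nseq k 0).
Proof.
elim/paired_ind=> [|x {}s even_x _ ps|x {}s odd_x _ ps] /=.
- by elim: k.
- by rewrite (negPf even_x).
- by rewrite odd_x eqxx.
Qed.

Lemma xi_eta_halves n la : size la <= n.*2 -> paired la ->
  let y := halves (la ++ nseq (n.*2 - size la) 0) in
  xi_eta la = (strip (evens y), strip (odds y)).
Proof.
move=> la_n pla; set p := la ++ _ => y.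
have size_p : size p = n.*2 by rewrite size_cat size_nseq subnKC.
have pp : paired p by apply: paired_pad.
have nth_p i : nth 0 p i = nth 0 la i.
  by rewrite nth_cat nth_nseq if_same; case: ltnP => // /(nth_default 0).
rewrite (xi_eta_pad la_n); have -> : star_at n.*2 la = rev (add_staircase p).
  by rewrite -star_at_staircase size_p; apply: eq_mkseq => i; rewrite nth_p.
rewrite !half_filter_rev /half_filter (filter_staircase_halves (or_introl erefl) pp).
rewrite (filter_staircase_halves (or_intror erefl) pp).
rewrite -/(half_filter odd _) -/(half_filter (predC odd) _) -!half_filter_rev.
have [|-> -> _ _ //] := unshift_staircase_double (y := halves p).
by rewrite size_halves // size_p odd_double.
Qed.

(** * Entries of u-symbols *)

Lemma rev_mkseq (f : nat -> nat) n :
  rev (mkseq f n) = mkseq (fun i => f (n - i.+1)) n.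
Proof.
apply: (@eq_from_nth _ 0); rewrite size_rev !size_mkseq // => i i_n.
by rewrite nth_rev !size_mkseq // !nth_mkseq //; lia.
Qed.

Lemma sum_mkseq (f g : nat -> nat) n :
  \sum_(z <- mkseq f n) g z = \sum_(i < n) g (f i).
Proof. by rewrite big_map -{1}(subn0 n) -/(index_iota 0 n) big_mkord. Qed.

Lemma sumn_mkseq (f : nat -> nat) n : sumn (mkseq f n) = \sum_(i < n) f i.
Proof. by rewrite sumnE (sum_mkseq f id). Qed.

Lemma paired_strip s : paired s -> paired (strip s).
Proof.
elim/paired_ind => //= x {}s.
  by move=> even_x _ ps; case: eqP => //= _; rewrite (negPf even_x).
by move=> odd_x _ ps; case: eqP odd_x => [->|_] //= odd_x; rewrite odd_x eqxx.
Qed.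

Lemma xi_eta_interleave n la (y := halves (la ++ nseq (n.*2 - size la) 0)) :
    sorted geq la -> size la <= n.*2 -> paired la ->
  [/\ near_sorted y,
      forall q, \sum_(i < q) nth 0 la i
                = (\sum_(i < q) nth 0 y i).*2 + pair_cut y q,
      forall i, nth 0 (xi_eta la).1 i = nth 0 y i.*2 &
      forall i, nth 0 (xi_eta la).2 i = nth 0 y i.*2.+1].
Proof.
move=> sla la_n pla.
have nth_p i : nth 0 (la ++ nseq (n.*2 - size la) 0) i = nth 0 la i.
  by rewrite nth_cat nth_nseq if_same; case: ltnP => // /(nth_default 0).
have sp : sorted geq (la ++ nseq (n.*2 - size la) 0).
  by apply: sorted_geq_of_nth => i; rewrite !nth_p sorted_geq_nth.
have pp : paired (la ++ nseq (n.*2 - size la) 0) by apply: paired_pad.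
have [near sums] := halves_sums pp sp; rewrite (xi_eta_halves la_n) // -/y.
split=> // [q|i|i]; first by rewrite -sums; apply: eq_bigr => i _; rewrite nth_p.
  rewrite nth_strip ?nth_evens //; apply: sorted_geq_of_nth => j.
  by rewrite !nth_evens doubleS; have [] := near j.*2.
rewrite nth_strip ?nth_odds //; apply: sorted_geq_of_nth => j.
by rewrite !nth_odds doubleS; have [] := near j.*2.+1.
Qed.

Definition symbol_entries (n : nat) (b : bipartition) : seq nat :=
  (u_symbol n b).1 ++ (u_symbol n b).2.

(** When y interleaves the components of a bipartition of n, these are the entries
    of its u-symbol. *)
Definition shifted (n : nat) (y : seq nat) : seq nat :=
  mkseq (fun i => nth 0 y i + (n.*2 - i)) n.*2.+1.

Lemma perm_alternate (f : nat -> nat) n :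
  perm_eq (mkseq (fun i => f i.*2) n.+1 ++ mkseq (fun i => f i.*2.+1) n)
          (mkseq f n.*2.+1).
Proof.
apply/seq.permP => a; rewrite count_cat; elim: n => [|n IHn]; first by rewrite addn0.
by move: IHn; rewrite doubleS !mkseqS -!cats1 !count_cat /= doubleS; lia.
Qed.

(** Both rows are read off from the single sequence f i = y_(2n - i) + i, the top
    one at even and the bottom one at odd places; the symbol is distinguished
    exactly because f increases. *)
Lemma symbol_interleave n y b :
    (forall i, nth 0 b.1 i = nth 0 y i.*2) ->
    (forall i, nth 0 b.2 i = nth 0 y i.*2.+1) ->
  perm_eq (symbol_entries n b) (shifted n y) /\
  (near_sorted y -> distinguished (u_symbol n b)).
Proof.
move=> b1 b2; pose f i := nth 0 y (n.*2 - i) + i.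
have E1 : (u_symbol n b).1 = mkseq (fun i => f i.*2) n.+1.
  apply/eq_in_map => i; rewrite mem_iota add0n b1 /f => i_n.
  by congr (nth 0 y _ + _); lia.
have E2 : (u_symbol n b).2 = mkseq (fun i => f i.*2.+1) n.
  apply/eq_in_map => i; rewrite mem_iota add0n b2 /f => i_n.
  by congr (nth 0 y _ + _); lia.
split.
  rewrite /symbol_entries E1 E2; apply: (perm_trans (perm_alternate f n)).
  rewrite -perm_rev rev_mkseq (_ : mkseq _ _ = shifted n y) //.
  apply/eq_in_map => i; rewrite mem_iota add0n /f => i_n.
  by congr (nth 0 y _ + _); lia.
move=> near; rewrite /distinguished E1 E2 size_mkseq.
apply/allP => i; rewrite mem_iota add0n => i_n.
rewrite !nth_mkseq //; try lia.
rewrite /f doubleS; apply/andP; split.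
  have [+ _] := near (n.*2 - i.*2.+1).
  by rewrite (_ : (n.*2 - i.*2.+1).+1 = n.*2 - i.*2); lia.
have [+ _] := near (n.*2 - i.*2.+2).
by rewrite (_ : (n.*2 - i.*2.+2).+1 = n.*2 - i.*2.+1); lia.
Qed.

Lemma sumn_shifted n y :
  sumn (shifted n y) = \sum_(i < n.*2.+1) nth 0 y i + sumn (shifted n [::]).
Proof.
rewrite !sumn_mkseq -big_split; apply: eq_bigr => i _.
by rewrite nth_nil.
Qed.

(** The constant term is the sum of the symbol of the empty bipartition. *)
Lemma sumn_symbol_entries n b : size b.1 <= n.+1 -> size b.2 <= n ->
  sumn (symbol_entries n b) = sumn b.1 + sumn b.2 + sumn (shifted n [::]).
Proof.
move=> b1 b2; have [||P0 _] := @symbol_interleave n [::] ([::], [::]).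
- by move=> i; rewrite !nth_nil.
- by move=> i; rewrite !nth_nil.
rewrite -(perm_sumn P0) !sumn_cat !sumn_mkseq.
rewrite (sumn_nth b1) (sumn_nth b2).
rewrite [\sum_(i < n.+1) nth 0 b.1 i](reindex_inj rev_ord_inj).
rewrite [\sum_(i < n) nth 0 b.2 i](reindex_inj rev_ord_inj) /=.
rewrite addnACA -!big_split /=; congr (_ + _); apply: eq_bigr => i _.
  by rewrite nth_nil subSS.
by rewrite nth_nil.
Qed.

(** Applied to the rows of a u-symbol: the symbol has at most two entries among any
    two consecutive integers, one in each row. *)
Lemma count_window v s : sorted (fun x z => x.+2 <= z) s ->
  count (fun z => v <= z <= v.+1) s <= 1.
Proof.
elim: s => //= x s IHs xs; have {}IHs := IHs (path_sorted xs).
case: (boolP (v <= x <= v.+1)) => // /andP[vx xv].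
suff /eqP-> : count (fun z => v <= z <= v.+1) s == 0 by [].
rewrite eqn0Ngt -has_count; apply/hasPn => z zs.
have gap_tr : transitive (fun x z => x.+2 <= z) by move=> a b c; lia.
by have /allP/(_ z zs) := order_path_min gap_tr xs; lia.
Qed.

Lemma symbol_rows_gap n b : is_partition b.1 -> is_partition b.2 ->
  sorted (fun x z => x.+2 <= z) (u_symbol n b).1 /\
  sorted (fun x z => x.+2 <= z) (u_symbol n b).2.
Proof.
case/andP=> s1 _ /andP[s2 _]; split.
  apply/(sortedP 0) => i; rewrite size_mkseq => i_n.
  have := sorted_geq_nth s1 (_ : n - i.+1 <= n - i).
  by rewrite !nth_mkseq ?(ltnW i_n) // => /(_ ltac:(lia)); lia.
apply/(sortedP 0) => i; rewrite size_mkseq => i_n.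
have := sorted_geq_nth s2 (_ : n - i.+2 <= n - i.+1).
by rewrite !nth_mkseq ?(ltnW i_n) // => /(_ ltac:(lia)); lia.
Qed.

(** Three entries among two consecutive integers would put two of them in one row,
    hence the gaps.  The lower bounds follow in steps of two places counted from
    the end, where 0 occurs just once: the bottom row has positive entries. *)
Lemma sorted_symbol n b (d := sort geq (symbol_entries n b)) :
    is_bipartition n b ->
  [/\ size d = n.*2.+1, sorted geq d,
      forall i, i < n.*2.-1 -> nth 0 d i.+2 + 2 <= nth 0 d i,
      forall i, i <= n.*2 -> n.*2 - i <= nth 0 d i &
      nth 0 d n.*2 = 0].
Proof.
case/and3P=> p1 p2 /eqP sum_n.
have sd : sorted geq d by apply: sort_sorted => x z; apply: leq_total.
have size_d : size d = n.*2.+1.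
  by rewrite size_sort size_cat !size_mkseq; lia.
have [g1 g2] := symbol_rows_gap n p1 p2.
have count_d a : count a d = count a (u_symbol n b).1 + count a (u_symbol n b).2.
  by rewrite count_sort count_cat.
have drop2 i : i < n.*2 ->
    drop i d = [:: nth 0 d i, nth 0 d i.+1 & drop i.+2 d].
  move=> i_n; rewrite (drop_nth 0); last by rewrite size_d; lia.
  by congr (_ :: _); rewrite (drop_nth 0) // size_d; lia.
have gap i : i < n.*2.-1 -> nth 0 d i.+2 + 2 <= nth 0 d i.
  (* Otherwise the entries of index i, i + 1, i + 2 lie in {v, v + 1}. *)
  move=> i_n; set v := nth 0 d i.+2; rewrite leqNgt; apply/negP => v_gt.
  pose a z := v <= z <= v.+1.
  have : count a d <= 2.
    by rewrite count_d (leq_add (count_window v g1) (count_window v g2)).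
  have d01 := sorted_geq_nth sd (leqnSn i).
  have d12 := sorted_geq_nth sd (leqnSn i.+1).
  rewrite -(cat_take_drop i d) count_cat drop2; last by lia.
  rewrite (drop_nth 0) ?size_d; last by lia.
  rewrite /= -/v /a leqnn leqnSn; move: d12; rewrite -/v => d12.
  have -> : v <= nth 0 d i <= v.+1 by lia.
  have -> : v <= nth 0 d i.+1 <= v.+1 by lia.
  by lia.
have d_last : nth 0 d n.*2 = 0.
  (* The top row starts with the part of index n of b.1, which has at most n parts. *)
  have : 0 \in d.
    rewrite mem_sort mem_cat; apply/orP; left; apply/(nthP 0).
    exists 0; rewrite ?size_mkseq // nth_mkseq // subn0 addn0 nth_default //.
    by apply: leq_trans (size_le_sumn _) _; [case/andP: p1|lia].
  case/(nthP 0) => i; rewrite size_d => i_n d0.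
  by have := sorted_geq_nth sd (_ : i <= n.*2); rewrite d0 => /(_ ltac:(lia)); lia.
split=> // i i_n; have [k ki] : exists k, k = n.*2 - i by eexists.
elim/ltn_ind: k i ki i_n => -[|[|k]] IHk i ki i_n; first by rewrite -ki.
  rewrite -ki lt0n; apply/negP => /eqP di.
  have: count (pred1 0) d <= 1.
    rewrite count_d -[1]addn0; apply: leq_add.
      apply: leq_trans (count_window 0 g1).
      by apply: sub_count => z /eqP->.
    rewrite leqn0 eqn0Ngt -has_count; apply/hasPn => z /mapP[j _ ->].
    by rewrite /= addnS.
  rewrite -(cat_take_drop i d) count_cat drop2 /= ?di; last by lia.
  rewrite (_ : i.+1 = n.*2) ?d_last ?eqxx; last by lia.
  by move: (count_mem 0 _) (count_mem 0 _) => /= c1 c2; lia.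
have /IHk/(_ i.+2) IHi : k < k.+2 by [].
by have := gap i; lia.
Qed.

(** * Monotonicity and injectivity of the Springer partition *)

Lemma shifted_surj n b : is_bipartition n b -> exists y,
  [/\ size y = n.*2, near_sorted y & sort geq (symbol_entries n b) = shifted n y].
Proof.
move=> Hb; have [size_d sd gap low last0] := sorted_symbol Hb.
set d := sort _ _ in size_d sd gap low last0 *.
pose y := mkseq (fun i => nth 0 d i - (n.*2 - i)) n.*2.
have nth_y i : nth 0 y i = nth 0 d i - (n.*2 - i).
  have [i_n | n_i] := ltnP i n.*2; first by rewrite nth_mkseq.
  rewrite nth_default ?size_mkseq //.
  by have := sorted_geq_nth sd n_i; rewrite last0; lia.
exists y; split; first by rewrite size_mkseq.
  move=> i; rewrite !nth_y.
  have d1 := sorted_geq_nth sd (leqnSn i); have d2 := sorted_geq_nth sd (leqnSn i.+1).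
  have := gap i; have := low i.
  have [n_i | i_n] := leqP n.*2.-1 i; last by lia.
  have := low i.+1; have := sorted_geq_nth sd (_ : n.*2 <= i.+2).
  rewrite last0; lia.
apply: (@eq_from_nth _ 0) => [|i]; rewrite size_d ?size_mkseq // => i_n.
by rewrite nth_mkseq // nth_y; have := low i; lia.
Qed.

(** A list y as here is found by subtracting the staircase from the sorted symbol,
    and [doubles] turns it into a symplectic partition with that symbol up to
    similarity.  This shows that the search defining [lambda] succeeds; what it
    finds, whichever solution it is, has the properties listed. *)
Lemma lambda_spec n b (la := lambda b) : is_bipartition n b -> exists y,
  [/\ is_partition_of n.*2 la, near_sorted y,
      forall q, sumn (take q la)
                = (\sum_(i < q) nth 0 y i).*2 + pair_cut y q &
      perm_eq (symbol_entries n b) (shifted n y)].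
Proof.
move=> Hb; have /and3P[p1 p2 /eqP sum_b] := Hb.
have size_la mu : is_partition_of n.*2 mu -> size mu <= n.*2.
  by case/andP=> /andP[_ mu0] /eqP <-; apply: size_le_sumn.
rewrite {}/la /lambda sum_b; set ok := (X in filter X).
suff /hasP[mu0 mu0P ok0] : has ok (partitions n.*2).
  have: head [::] (filter ok (partitions n.*2)) \in filter ok (partitions n.*2).
    have: mu0 \in filter ok (partitions n.*2) by rewrite mem_filter ok0.
    by case: (filter _ _) => //= mu s _; rewrite mem_head.
  set la := head _ _; rewrite mem_filter mem_partitions.
  case/andP=> /and3P[sym_la _ sim] part_la; have s_la := size_la _ part_la.
  have /andP[/andP[sorted_la _] _] := part_la.
  rewrite symplectic_paired // in sym_la.
  have [near sums y1 y2] := xi_eta_interleave sorted_la s_la sym_la.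
  set y := halves _ in near sums y1 y2.
  exists y; split=> // [q|]; first by rewrite sumn_take_nth sums.
  have [P _] := symbol_interleave n y1 y2.
  by apply: perm_trans P; rewrite perm_sym.
have [y [size_y near dE]] := shifted_surj Hb.
have [pp sp hy] := doublesP near.
pose p := doubles y; pose mu := strip p.
have size_p : size p = n.*2 by rewrite -size_halves // hy.
have nth_mu i : nth 0 mu i = nth 0 p i by rewrite nth_strip.
have part_mu : is_partition mu := is_partition_strip sp.
have size_mu : size mu <= n.*2 by rewrite size_filter -size_p count_size.
have mu_pad : mu ++ nseq (n.*2 - size mu) 0 = p.
  apply: (@eq_from_nth _ 0) => [|i _].
    by rewrite size_cat size_nseq size_p subnKC.
  by rewrite nth_cat nth_nseq if_same -nth_mu; case: ltnP => // /(nth_default 0).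
have pm : paired mu := paired_strip pp.
have /andP[smu _] := part_mu.
have [_ sums y1 y2] := xi_eta_interleave smu size_mu pm.
rewrite mu_pad hy in sums y1 y2.
have [P D] := symbol_interleave n y1 y2.
have sum_y : \sum_(i < n.*2.+1) nth 0 y i = n.
  apply/(@addIn (sumn (shifted n [::]))); rewrite -sumn_shifted -dE.
  have b1 : size b.1 <= n.+1.
    by case/andP: p1 => _ /size_le_sumn/leq_trans; apply; lia.
  have b2 : size b.2 <= n.
    by case/andP: p2 => _ /size_le_sumn/leq_trans; apply; lia.
  rewrite -{2}sum_b -sumn_symbol_entries //.
  by apply: perm_sumn; rewrite perm_sort.
have y_last : nth 0 y n.*2 = 0 by rewrite nth_default ?size_y.
have sum_mu : sumn mu = n.*2.
  rewrite (sumn_nth size_mu) sums /pair_cut y_last ltn0 andbF addn0.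
  by move: sum_y; rewrite big_ord_recr /= y_last addn0 => ->.
apply/hasP; exists mu.
  by rewrite mem_partitions /is_partition_of part_mu sum_mu /=.
rewrite /ok symplectic_paired // pm D //=.
by apply: (perm_trans P); rewrite -dE perm_sort.
Qed.

Lemma lambda_partition n b : is_bipartition n b ->
  is_partition_of n.*2 (lambda b).
Proof. by case/lambda_spec => y []. Qed.

(** If the cut splits an ascent of y and the two sums are equal, then comparing the
    sums one term before and one term after gives y'_(q-1) <= y_(q-1) and
    y_q <= y'_q, so that y' has an ascent at the same place. *)
Lemma pair_cut_le y y' q :
    (forall k, k <= q.+1 ->
       \sum_(i < k) nth 0 y i <= \sum_(i < k) nth 0 y' i) ->
  (\sum_(i < q) nth 0 y i).*2 + pair_cut y q
    <= (\sum_(i < q) nth 0 y' i).*2 + pair_cut y' q.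
Proof.
case: q => [|q] le_sum; first by rewrite !big_ord0.
have := le_sum q.+1; have := le_sum q.+2; have := le_sum q.
rewrite !big_ord_recr /pair_cut /=; lia.
Qed.

(** Thresholds reduce the comparison of the two symbols to that of their bottom
    rows, and these are eta and eta2 plus the same strictly decreasing sequence. *)
Lemma lambda_mono n xi eta eta2 :
    is_bipartition n (xi, eta) -> is_bipartition n (xi, eta2) ->
  dominated eta eta2 -> dominated (lambda (xi, eta)) (lambda (xi, eta2)).
Proof.
move=> Hb Hc dom.
have [y [/andP[_ /eqP sum_b] near sums_y Py]] := lambda_spec Hb.
have [y' [/andP[_ /eqP sum_c] near' sums_y' Py']] := lambda_spec Hc.
have noninc z : near_sorted z ->
    forall i j, i <= j < n.*2.+1 -> nth 0 z j + (n.*2 - j) <= nth 0 z i + (n.*2 - i).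
  move=> nz i j /andP[ij jn]; elim: j ij jn => [|j IHj].
    by rewrite leqn0 => /eqP->.
  rewrite leq_eqVlt ltnS => /predU1P[-> //|/IHj {}IHj jn].
  by apply: leq_trans (IHj (ltnW jn)); have [] := nz j; lia.
have eta_noninc : forall i j, i <= j < n ->
    nth 0 eta j + (n - j.+1).*2.+1 <= nth 0 eta i + (n - i.+1).*2.+1.
  have /and3P[_ /andP[se _] _] := Hb; move=> i j /andP[ij jn].
  have := sorted_geq_nth se ij => /=; lia.
have thr t : \sum_(z <- symbol_entries n (xi, eta)) (z - t)
               <= \sum_(z <- symbol_entries n (xi, eta2)) (z - t).
  rewrite !big_cat leq_add2l /= !(sum_mkseq _ (fun z => z - t)).
  (* The rows list the parts in increasing order, hence the reversal. *)
  rewrite (reindex_inj rev_ord_inj) [X in _ <= X](reindex_inj rev_ord_inj) /=.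
  have E (e : seq nat) :
      \sum_(j < n) (nth 0 e (n - (n - j.+1).+1) + (n - j.+1).*2.+1 - t)
      = \sum_(j < n) (nth 0 e j + (n - j.+1).*2.+1 - t).
    by apply: eq_bigr => i _; rewrite subnSK // subKn // ltnW.
  rewrite !E.
  apply: (threshold_le (g := fun i => nth 0 eta2 i + (n - i.+1).*2.+1) eta_noninc).
  move=> k _.
  by rewrite !big_split leq_add2r -!sumn_take_nth dom.
have sum_le k : k <= n.*2.+1 ->
    \sum_(i < k) nth 0 y i <= \sum_(i < k) nth 0 y' i.
  move=> kn; rewrite -(leq_add2r (\sum_(i < k) (n.*2 - i))) -!big_split /=.
  apply: (prefix_sum_le (f := fun i => nth 0 y i + (n.*2 - i)) (noninc _ near')) kn.
  move=> t.
  have := thr t; rewrite (perm_big _ Py) (perm_big _ Py').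
  by rewrite !(sum_mkseq _ (fun z => z - t)).
move=> q; have [q_n | n_q] := leqP q n.*2.
  rewrite sums_y sums_y'; apply: pair_cut_le => k kq.
  by apply: sum_le; apply: leq_trans kq _.
have size_la b : is_bipartition n b -> size (lambda b) <= n.*2.
  by case/lambda_partition/andP=> /andP[_ l0] /eqP <-; apply: size_le_sumn.
by rewrite !take_oversize ?sum_b ?sum_c // (leq_trans (size_la _ _)) // ltnW.
Qed.

(** The partial sums of lambda determine those of y, the correction being 0 or 1,
    hence the symbol up to similarity; removing the common top row leaves the
    bottom row, whose order is known since it is increasing. *)
Lemma lambda_inj n xi eta eta2 :
    is_bipartition n (xi, eta) -> is_bipartition n (xi, eta2) ->
  lambda (xi, eta) = lambda (xi, eta2) -> eta = eta2.
Proof.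
move=> Hb Hc eq_la.
have [y [_ _ sums_y Py]] := lambda_spec Hb.
have [y' [_ _ sums_y' Py']] := lambda_spec Hc.
have sum_eq k : \sum_(i < k) nth 0 y i = \sum_(i < k) nth 0 y' i.
  have := sums_y k; rewrite eq_la sums_y'; do 2!case: pair_cut; lia.
have yE i : nth 0 y i = nth 0 y' i.
  by have := sum_eq i.+1; rewrite !big_ord_recr /= sum_eq => /addnI.
have /(perm_trans Py) : perm_eq (shifted n y) (shifted n y').
  by apply/seq.permP => a; congr (count _ _); apply: eq_mkseq => i; rewrite yE.
move: Py'; rewrite perm_sym => /[swap] /perm_trans /[apply].
have /and3P[/= p0 p1 /eqP s1] := Hb; have /and3P[/= _ p2 /eqP s2] := Hc.
rewrite /symbol_entries perm_cat2l => perm_bottom.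
have sorted_bottom b : is_partition b.1 -> is_partition b.2 ->
    sorted leq (u_symbol n b).2.
  move=> b1 b2; have [_] := symbol_rows_gap n b1 b2.
  by apply: sub_sorted => x z; lia.
have := sorted_eq leq_trans anti_leq (sorted_bottom (xi, eta) p0 p1)
  (sorted_bottom (xi, eta2) p0 p2) perm_bottom.
move=> /= bottomE; apply: is_partition_eq => // i.
have size_le e : is_partition e -> sumn xi + sumn e = n -> size e <= n.
  by case/andP=> _ /size_le_sumn/leq_trans + sum_e; apply; lia.
have [i_n | n_i] := ltnP i n; last first.
  by rewrite !nth_default // (leq_trans _ n_i) // size_le.
have /(congr1 (fun s => nth 0 s (n - i.+1))) := bottomE.
rewrite !nth_mkseq ?subnSK ?subKn ?(ltnW i_n) //; lia.
Qed.

(** * Scalar product of two induced multiplicative functions *)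

Section Multiplicative.

Local Open Scope group_scope.
Local Open Scope ring_scope.

Variables (gT : finGroupType) (G : {group gT}).

Lemma multiplicative_char (phi : 'CF(G)) :
    phi 1%g = 1 -> {in G &, {morph phi : x y / (x * y)%g >-> x * y}} ->
  phi \is a character.
Proof.
move=> phi1 phiM; pose r x : 'M[algC]_1 := (phi x)%:M.
have rP : mx_repr G r.
  split=> [|x y Gx Gy]; first by rewrite /r phi1.
  by rewrite /r phiM // scalar_mxM.
suff -> : phi = cfRepr (MxRepresentation rP) by apply: cfRepr_char.
apply/cfunP => x; rewrite cfunE /= mxtrace_scalar mulr1n.
by case: (boolP (x \in G)) => // /cfun0->.
Qed.

Variables H K : {group gT}.
Hypotheses (sHG : H \subset G) (sKG : K \subset G).
Variables (phi : 'CF(H)) (psi : 'CF(K)).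
Hypothesis phiM : {in H &, {morph phi : x y / (x * y)%g >-> x * y}}.
Hypothesis psiM : {in K &, {morph psi : x y / (x * y)%g >-> x * y}}.

Let agree y := [forall x in H, (x ^ y \in K)%g ==> (phi x * (psi (x ^ y)%g)^* == 1)].

(** Mackey's formula in degree one.  The scalar product is a positive multiple of a
    sum over y in G of sums of a multiplicative function over the group of the x in
    H with x ^ y in K.  Such a sum is 0 unless the function is trivial, and then it
    is the order of the group, so that nothing cancels. *)
Lemma cfdot_Ind_multiplicative :
  ('['Ind[G] phi, 'Ind[G] psi] != 0) = [exists y in G, agree y].
Proof.
pose L y := (H :&: K :^ y^-1)%G.
have LP x y : (x \in L y) = (x \in H) && ((x ^ y)%g \in K).
  by rewrite inE mem_conjgV.
pose S y := \sum_(x in H) phi x * (psi (x ^ y)%g)^*.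
have SE y : S y = if agree y then #|L y|%:R else 0.
  have -> : S y = \sum_(x in L y) phi x * (psi (x ^ y)%g)^*.
    rewrite /S (bigID (mem (L y))) /= [X in _ + X]big1 ?addr0.
      by apply: eq_bigl => x; rewrite LP; case: (x \in H).
    by move=> x; rewrite LP => /andP[-> /= /cfun0->]; rewrite conjC0 mulr0.
  case: ifPn => [/forall_inP agree_y | ].
    rewrite (eq_bigr (fun=> 1)) ?sumr_const // => x; rewrite LP => /andP[Hx Kx].
    exact/eqP/(implyP (agree_y x Hx)).
  rewrite negb_forall_in => /exists_inP[z Hz]; rewrite negb_imply => /andP[Kz].
  set c := _ * _ => c1; set T := \sum_(x in _) _.
  have Lz : z \in L y by rewrite LP Hz.
  (* Translation by z, at which the function takes the value c, permutes the terms. *)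
  have TE : T = T * c.
    rewrite {1}/T (reindex_inj (mulIg z)) /= mulr_suml.
    apply: eq_big => [x | x]; first by rewrite groupMr.
    rewrite groupMr // => /[!LP] /andP[Hx Kx].
    by rewrite phiM // conjMg psiM // rmorphM /= mulrACA.
  apply/eqP; have /eqP : T * (c - 1) = 0 by rewrite mulrBr mulr1 -TE subrr.
  by rewrite mulf_eq0 subr_eq0 (negPf c1) orbF.
have -> : '['Ind[G] phi, 'Ind[G] psi]
    = #|H|%:R^-1 * #|K|%:R^-1 * \sum_(y in G) S y.
  rewrite -Frobenius_reciprocity cfdotE -mulrA; congr (_ * _).
  rewrite mulr_sumr; under [RHS]eq_bigr do rewrite mulr_sumr.
  rewrite [RHS]exchange_big; apply: eq_bigr => x Hx /=.
  rewrite cfResE // cfIndE // rmorphM /= fmorphV /= rmorph_nat rmorph_sum.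
  by rewrite mulrCA mulr_sumr mulr_sumr; apply: eq_bigr => y _; rewrite mulrCA.
rewrite mulf_eq0 negb_or mulf_neq0 ?invr_eq0 ?neq0CG //=.
have S_ge0 y : 0 <= S y by rewrite SE; case: ifP.
rewrite psumr_neq0 //; apply/hasP/exists_inP => [[y _ /andP[Gy Sy]] | [y Gy ay]].
  by exists y => //; move: Sy; rewrite SE; case: ifP; rewrite ?ltxx.
exists y; rewrite ?mem_index_enum //= Gy SE ay ltr0n cardG_gt0 //.
Qed.

End Multiplicative.

(** * Characters of label stabilisers *)

Section LabelSigns.

Local Open Scope group_scope.
Local Open Scope ring_scope.

Variable n : nat.
Implicit Types (f g : 'I_n -> bool * nat) (x y : signed_perm n).

Lemma label_charE f tw x : x \in label_stab f ->
  label_char f tw x = label_sign f tw x.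
Proof. by move=> fx; rewrite cfunElock fx. Qed.

Lemma label_char1 f tw : label_char f tw 1%g = 1.
Proof.
rewrite label_charE ?group1 // /label_sign /= odd_perm1 andbF mul1r big1 // => i _.
by rewrite ffunE.
Qed.

Lemma label_charM f tw :
  {in label_stab f &, {morph label_char f tw : x y / (x * y)%g >-> x * y}}.
Proof. by move=> x y fx fy; rewrite !label_charE ?groupM // label_signM. Qed.

Lemma signed_perm_conj1 x y : (x ^ y)%g.1 = (x.1 ^ y.1)%g.
Proof. by []. Qed.

Lemma signed_perm_conj2 x y i :
  (x ^ y)%g.2 (y.1 i) = x.2 i (+) (y.2 i (+) y.2 (x.1 i)).
Proof.
have mul2 (u v : signed_perm n) j : (u * v)%g.2 j = u.2 j (+) v.2 (u.1 j).
  exact: ffunE.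
have inv2 (u : signed_perm n) j : (u^-1)%g.2 j = u.2 (u.1^-1%g j) by apply: ffunE.
by rewrite conjgE !mul2 inv2 [(y^-1)%g.1]/(y.1^-1)%g permK addbCA.
Qed.

Lemma mem_label_stabJ g x y :
  ((x ^ y)%g \in label_stab g) = (x \in label_stab (fun i => g (y.1 i))).
Proof.
rewrite !inE; apply/forallP/forallP => gx i.
  by have := gx (y.1 i); rewrite signed_perm_conj1 permJ.
by have := gx ((y.1)^-1%g i); rewrite signed_perm_conj1 -permJ permKV.
Qed.

(** The sign changes of y occur twice, once at i and once at x.1 i, and the two
    occurrences cancel because x.1 preserves the transported labels. *)
Lemma label_signJ g x y : (x ^ y)%g \in label_stab g ->
  label_sign g true (x ^ y)%g = label_sign (fun i => g (y.1 i)) true x.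
Proof.
rewrite mem_label_stabJ inE => /forallP gx.
rewrite /label_sign (_ : (x ^ y)%g.1 = (x.1 ^ y.1)%g) // odd_permJ; congr (_ * _).
rewrite (reindex_inj (@perm_inj _ y.1)) /=.
under eq_bigr => i _ do rewrite signed_perm_conj2 signr_addb.
rewrite big_split -[RHS]mulr1; congr (_ * _).
under eq_bigr => i _ do rewrite signr_addb.
rewrite big_split /= [X in _ * X](_ : _ = \prod_(i | (g (y.1 i)).1) (-1) ^+ y.2 i).
  by rewrite -big_split big1 // => i _ /=; rewrite -signr_addb addbb.
rewrite [RHS](reindex_inj (@perm_inj _ x.1)) /=.
by apply: eq_bigl => i; rewrite (eqP (gx i)).
Qed.

(** Here s is the permutation underlying the signed permutation of Mackey's formula.
    Agreement of the two signs on a single sign change means that s preserves the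
    first component of the labels.  A transposition within a fibre of f has sign 1
    for f and would have sign -1 for g if it also were within a fibre of g after
    transport by s.  Conversely, injectivity of (f, g o s) leaves only sign changes
    to be compared. *)
Lemma cfdot_label f g :
  reflect (exists s : {perm 'I_n},
             (forall i, (f i).1 = (g (s i)).1) /\
             (forall i j, f i = f j -> g (s i) = g (s j) -> i = j))
    ('['Ind[W n] (label_char f false), 'Ind[W n] (label_char g true)] != 0).
Proof.
rewrite cfdot_Ind_multiplicative ?subsetT ?label_char1 //;
  try exact: label_charM.
have agreeE y x : x \in label_stab f -> (x ^ y)%g \in label_stab g ->
    label_char f false x * (label_char g true (x ^ y)%g)^* =
    label_sign f false x * label_sign (fun i => g (y.1 i)) true x.
  move=> fx gx; rewrite !label_charE // label_signJ //; congr (_ * _).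
  rewrite /label_sign rmorphM rmorph_sign /=; congr (_ * _).
  by rewrite rmorph_prod; apply: eq_bigr => i _; rewrite rmorph_sign.
apply: (iffP exists_inP) => [[y _ /forall_inP agree] | [s [fst_s inj_s]]].
  exists y.1; split=> [i | i j fij gij].
    pose x : signed_perm n := (1%g, [ffun k => k == i]).
    have fx : x \in label_stab f by rewrite inE; apply/forallP => k; rewrite perm1.
    have gx : (x ^ y)%g \in label_stab g.
      by rewrite mem_label_stabJ inE; apply/forallP => k; rewrite perm1.
    have /implyP/(_ gx)/eqP := agree x fx; rewrite agreeE //.
    have signE h tw : label_sign h tw x = (-1) ^+ (h i).1.
      rewrite /label_sign odd_perm1 andbF mul1r (bigID (pred1 i)) /= mulrC big1 ?mul1r.
        case: (boolP (h i).1) => hi; last first.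
          by rewrite big1 // => k /andP[hk /eqP ki]; rewrite -ki hk in hi.
        rewrite (big_pred1 i) ?ffunE ?eqxx // => k.
        by rewrite /= andbC; case: eqP => // ->.
      by move=> k /andP[_ /negPf ki]; rewrite ffunE ki.
    rewrite !signE -signr_addb => /(@signr_inj _ _ false).
    by do 2!case: (_.1).
  pose x : signed_perm n := (tperm i j, [ffun=> false]).
  have fx : x \in label_stab f.
    by rewrite inE; apply/forallP => k /=; case: tpermP => // ->; rewrite fij.
  have gx : (x ^ y)%g \in label_stab g.
    rewrite mem_label_stabJ inE; apply/forallP => k /=.
    by case: tpermP => // ->; rewrite gij.
  have /implyP/(_ gx)/eqP := agree x fx; rewrite agreeE //.
  have signE h tw : label_sign h tw x = (-1) ^+ (tw && (i != j)).
    rewrite /label_sign odd_tperm big1 ?mulr1 // => k _.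
    by rewrite ffunE.
  by rewrite !signE mul1r => /(@signr_inj _ _ false)/negbFE/eqP.
exists (s, [ffun=> false]); first by rewrite inE.
apply/forall_inP => x fx; apply/implyP => gx; rewrite agreeE //.
have x1 : x.1 = 1%g.
  apply/permP => i; rewrite perm1; apply: inj_s.
    by move: fx; rewrite inE => /forallP/(_ i)/eqP.
  by move: gx; rewrite mem_label_stabJ inE => /forallP/(_ i)/eqP.
rewrite /label_sign x1 odd_perm1 !mul1r; apply/eqP.
under [X in _ * X]eq_bigl => i do rewrite -fst_s.
by rewrite -big_split big1 // => i _ /=; rewrite -signr_addb addbb.
Qed.

End LabelSigns.

(** * Boxes of a pair of Young diagrams *)

Definition component (b : bipartition) (c : bool) : seq nat :=
  if c then b.2 else b.1.

Definition component_boxes (c : bool) (la : seq nat) : seq (bool * (nat * nat)) :=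
  [seq (c, (i, j)) | i <- iota 0 (size la), j <- iota 0 (nth 0 la i)].

Lemma boxesE la mu :
  boxes la mu = component_boxes false la ++ component_boxes true mu.
Proof. by []. Qed.

Lemma mem_component_boxes c la d i j :
  ((d, (i, j)) \in component_boxes c la) = (d == c) && (j < nth 0 la i).
Proof.
apply/allpairsPdep/andP => [[i' [j' []]]|[/eqP-> j_lt]].
  by rewrite !mem_iota /= !add0n => _ j_lt [-> -> ->].
exists i, j; rewrite !mem_iota /= !add0n; split=> //.
by case: ltnP => // /(nth_default 0) la0; rewrite la0 in j_lt.
Qed.

Lemma mem_boxes b c i j :
  ((c, (i, j)) \in boxes b.1 b.2) = (j < nth 0 (component b c) i).
Proof. by rewrite boxesE mem_cat !mem_component_boxes; case: c; rewrite ?orbF. Qed.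

Lemma boxes_uniq la mu : uniq (boxes la mu).
Proof.
have comp_uniq c s : uniq (component_boxes c s).
  apply: allpairs_uniq_dep => [|i _|[i j] [i' j'] _ _ [-> ->]] //.
    exact: iota_uniq.
  exact: iota_uniq.
rewrite boxesE cat_uniq !comp_uniq andbT /=; apply/hasPn => -[d [i j]].
by rewrite !mem_component_boxes; case: d.
Qed.

Lemma count_first_rows b c k :
  count (fun x => (x.1 == c) && (x.2.1 < k)) (boxes b.1 b.2)
    = sumn (take k (component b c)).
Proof.
have comp d la : count (fun x => (x.1 == c) && (x.2.1 < k)) (component_boxes d la)
    = if d == c then sumn (take k la) else 0.
  rewrite count_flatten -map_comp.
  rewrite (eq_map (g := fun i => if (d == c) && (i < k) then nth 0 la i else 0)).
    rewrite sumnE big_map -{1}(subn0 (size la)) -/(index_iota 0 (size la)) big_mkord.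
    case: eqP => _; last by rewrite big1.
    rewrite -big_mkcond /= sumn_take_nth.
    have [k_le | le_k] := leqP k (size la).
      by rewrite (big_ord_narrow k_le).
    rewrite -[RHS](big_mkord xpredT (nth 0 la)).
    rewrite (@big_cat_nat _ _ _ (size la)) ?(ltnW le_k) //=.
    rewrite [X in _ = _ + X]big_nat_cond [X in _ = _ + X]big1 ?addn0.
      rewrite big_mkord; apply: eq_bigl => i.
      by rewrite (ltn_trans (ltn_ord i) le_k).
    by move=> i /andP[/andP[la_i _] _]; rewrite nth_default.
  move=> i /=; rewrite count_map.
  rewrite (eq_count (a2 := fun=> (d == c) && (i < k))) //.
  by case: ifP => _; rewrite ?count_predT ?size_iota ?count_pred0.
rewrite boxesE count_cat !comp /component; case: c {comp} => //=.
by rewrite addn0.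
Qed.

Lemma size_boxes b : size (boxes b.1 b.2) = sumn b.1 + sumn b.2.
Proof.
have all_rows c : count (fun x => (x.1 == c) && (x.2.1 < size (component b c)))
    (boxes b.1 b.2) = sumn (component b c).
  by rewrite count_first_rows take_size.
rewrite -(all_rows false) -(all_rows true) -count_predUI.
rewrite [X in _ = _ + X](eq_count (a2 := pred0)) ?count_pred0 ?addn0; last first.
  by move=> [[] [i j]] //=; rewrite andbF.
rewrite -(count_predT (boxes _ _)); apply: eq_in_count => -[c [i j]].
rewrite mem_boxes /=; case: ltnP => //; case: c => /= lt_j.
  by case: ltnP => // /(nth_default 0) b0; rewrite b0 in lt_j.
by rewrite orbF; case: ltnP => // /(nth_default 0) b0; rewrite b0 in lt_j.
Qed.

Section Boxes.

Variables (n : nat) (b : bipartition).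
Hypothesis Hb : is_bipartition n b.

Notation boxb := (@box n b.1 b.2).

Lemma size_boxes_bip : size (boxes b.1 b.2) = n.
Proof. by rewrite size_boxes; case/and3P: Hb => _ _ /eqP. Qed.

Lemma box_inj : injective boxb.
Proof.
move=> i j /eqP; rewrite nth_uniq ?size_boxes_bip ?boxes_uniq // => /eqP.
exact: val_inj.
Qed.

Lemma box_component (i : 'I_n) :
  (boxb i).2.2 < nth 0 (component b (boxb i).1) (boxb i).2.1.
Proof.
have : boxb i \in boxes b.1 b.2 by rewrite mem_nth ?size_boxes_bip.
by case: (boxb i) => c [j k]; rewrite mem_boxes.
Qed.

Lemma box_surj c j k : k < nth 0 (component b c) j ->
  {i : 'I_n | boxb i = (c, (j, k))}.
Proof.
rewrite -mem_boxes => mem_b; have i_lt := mem_b.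
rewrite -index_mem size_boxes_bip in i_lt.
by exists (Ordinal i_lt); rewrite /box nth_index.
Qed.

Lemma card_first_rows c k :
  #|[set i : 'I_n | ((boxb i).1 == c) && ((boxb i).2.1 < k)]|
    = sumn (take k (component b c)).
Proof.
rewrite -count_first_rows cardE size_filter.
rewrite -[boxes _ _](mkseq_nth (false, (0, 0))) size_boxes_bip.
rewrite /mkseq count_map -val_enum_ord.
rewrite count_map enumT.
by apply: eq_count => i /=; rewrite inE.
Qed.

End Boxes.

(** The boxes in the first k rows of b are sent to boxes of b' at most k of which
    are in the same column.  A column of b' either lies within the first k rows or
    has k boxes there; in both cases it has at least as many boxes in the first k
    rows as it receives. *)
Lemma dominated_of_labels n b b' c (s : {perm 'I_n}) :
    is_bipartition n b -> is_bipartition n b' ->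
    (forall i, (row_label b.1 b.2 i).1 = (col_label b'.1 b'.2 (s i)).1) ->
    (forall i j : 'I_n, row_label b.1 b.2 i = row_label b.1 b.2 j ->
       col_label b'.1 b'.2 (s i) = col_label b'.1 b'.2 (s j) -> i = j) ->
  dominated (component b c) (component b' c).
Proof.
move=> Hb Hb' fst_s inj_s k.
rewrite -(card_first_rows Hb) -(card_first_rows Hb').
set A := [set i | _]; set B := [set i | _].
rewrite -(card_imset _ (@perm_inj _ s)).
(* Both sides are counted column by column. *)
pose col (i : 'I_n) : 'I_n.+1 := inord (box b'.1 b'.2 i).2.2.
have colE i : col i = (box b'.1 b'.2 i).2.2 :> nat.
  apply: inordK; rewrite ltnS ltnW //.
  apply: leq_trans (box_component Hb' i) _.
  have /and3P[_ _ /eqP sum_b'] := Hb'.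
  set t := component _ _; set r := _.2.1.
  have t_le : sumn t <= n.
    rewrite -[n in _ <= n]sum_b' /t /component.
    by case: ifP; rewrite ?leq_addl ?leq_addr.
  apply: leq_trans t_le; rewrite (sumn_nth (k := maxn (size t) r.+1)) ?leq_maxl //.
  have r_lt : r < maxn (size t) r.+1 by rewrite leq_maxr.
  by rewrite (bigD1 (Ordinal r_lt)) //= leq_addr.
rewrite -!sum1_card (partition_big col predT) //=.
rewrite [X in _ <= X](partition_big col predT) //=.
apply: leq_sum => j _; rewrite !sum1dep_card.
set Aj := [set _ | _]; set Bj := [set _ | _].
have sA i : i \in Aj -> exists2 h : 'I_n, i = s h &
    (box b.1 b.2 h).1 = c /\ (box b.1 b.2 h).2.1 < k.
  rewrite inE => /andP[/imsetP[h + ->] _]; rewrite inE => /andP[/eqP hc hk].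
  by exists h.
have fstA i : i \in Aj -> (box b'.1 b'.2 i).1 = c.
  by case/sA => h -> [<- _]; rewrite -[RHS]/(row_label b.1 b.2 h).1 fst_s.
(* Otherwise i0 is a box of the column below the first k rows, and the column
   meets all these rows. *)
have [/subset_leq_card // | /subsetPn[i0 i0A i0B]] := boolP (Aj \subset Bj).
(* Boxes sent to the same column come from different rows among the first k. *)
have Aj_le : #|Aj| <= k.
  pose row (i : 'I_n) := (box b.1 b.2 (s^-1%g i)).2.1.
  have row_inj : {in Aj &, injective row}.
    move=> i i' iA iA' row_eq; apply: (@perm_inj _ s^-1%g); apply: inj_s.
      rewrite /row_label -/(row i) -/(row i') row_eq; congr (_, _).
      case/sA: (iA) => h -> [hc _]; case/sA: (iA') => h' -> [hc' _].
      by rewrite !permK hc hc'.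
    rewrite !permKV /col_label !fstA // -!colE.
    by move: iA iA'; rewrite !inE => /andP[_ /eqP->] /andP[_ /eqP->].
  rewrite cardE -(size_map row) -(size_iota 0 k); apply: uniq_leq_size.
    rewrite map_inj_in_uniq ?enum_uniq // => i i'; rewrite !mem_enum.
    exact: row_inj.
  move=> _ /mapP[i + ->]; rewrite mem_enum mem_iota => /sA[h -> [_ hk]].
  by rewrite /row permK.
apply: leq_trans Aj_le _.
have k_lt : forall r : 'I_k, j < nth 0 (component b' c) r.
  move=> r; have i0j : col i0 = j by move: i0A; rewrite inE => /andP[_ /eqP].
  have k_le : k <= (box b'.1 b'.2 i0).2.1.
    by move: i0B; rewrite !inE fstA // i0j !eqxx andbT -leqNgt.
  have := box_component Hb' i0; rewrite fstA // -colE i0j => /leq_trans; apply.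
  have comp_sorted : sorted geq (component b' c).
    by have /and3P[/andP[s1 _] /andP[s2 _] _] := Hb'; case: (c).
  exact: sorted_geq_nth comp_sorted _ _ (leq_trans (ltnW (ltn_ord r)) k_le).
pose g (r : 'I_k) : 'I_n := sval (box_surj Hb' (k_lt r)).
have gE r : box b'.1 b'.2 (g r) = (c, (val r, val j)) by apply: (svalP (box_surj _ _)).
have g_inj : injective g.
  by move=> r r' /(congr1 (@box n b'.1 b'.2)); rewrite !gE => -[/val_inj].
rewrite -[k in k <= _]card_ord -(card_imset _ g_inj).
apply: subset_leq_card; apply/subsetP => _ /imsetP[r _ ->].
by rewrite !inE gE eqxx ltn_ord /= -val_eqE /= colE gE.
Qed.

(** * Distinct bipartitions label distinct characters *)

Section LabelledCharacters.

Local Open Scope group_scope.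
Local Open Scope ring_scope.

Lemma label_Ind_char n (f : 'I_n -> bool * nat) tw :
  'Ind[W n] (label_char f tw) \is a character.
Proof.
apply: cfInd_char; apply: multiplicative_char (label_char1 f tw) _.
exact: label_charM.
Qed.

Lemma common_constt (gT : finGroupType) (G : {group gT}) (phi psi : 'CF(G)) :
    phi \is a character -> psi \is a character ->
  ('[phi, psi] != 0) = [exists t, (t \in irr_constt phi) && (t \in irr_constt psi)].
Proof.
move=> Nphi Npsi.
have irr_ge0 (chi : 'CF(G)) i : chi \is a character -> 0 <= '[chi, 'chi_i].
  by move=> Nchi; apply/natr_ge0/Cnat_cfdot_char_irr.
rewrite cfdot_sum_irr psumr_neq0; last first.
  by move=> i _; rewrite mulr_ge0 ?conjC_ge0 ?irr_ge0.
apply/hasP/existsP => -[t].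
  move=> _ /= /lt0r_neq0; rewrite mulf_eq0 conjC_eq0 negb_or => /andP[h1 h2].
  by exists t; rewrite !irr_consttE h1.
rewrite !irr_consttE => /andP[h1 h2]; exists t; rewrite ?mem_index_enum //=.
rewrite lt0r mulf_neq0 ?conjC_eq0 // mulr_ge0 ?conjC_ge0 ?irr_ge0 //.
Qed.

(** A box is determined by its row and its column, so the identity permutation
    shows that the two induced characters have a common constituent. *)
Lemma chi_idxP n b : is_bipartition n b ->
  (chi_idx n b.1 b.2
     \in irr_constt ('Ind[W n] (label_char (@row_label n b.1 b.2) false))) /\
  (chi_idx n b.1 b.2
     \in irr_constt ('Ind[W n] (label_char (@col_label n b.1 b.2) true))).
Proof.
move=> Hb; suff: '['Ind[W n] (label_char (@row_label n b.1 b.2) false),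
                   'Ind[W n] (label_char (@col_label n b.1 b.2) true)] != 0.
  rewrite common_constt ?label_Ind_char // /chi_idx.
  by case: pickP => [t /andP[] | no_t /existsP[t]] //; rewrite no_t.
apply/cfdot_label; exists 1%g; split=> [i | i j]; first by rewrite perm1.
rewrite !perm1 /row_label /col_label => -[_ rowE] [cE colE].
apply: (box_inj Hb); move: rowE cE colE.
by case: (box _ _ i) (box _ _ j) => c [r k] [c' [r' k']] /= -> -> ->.
Qed.

(** The common character is a constituent both of the character induced from the
    rows of b and of the one induced from the columns of b'. *)
Lemma chi_dominated n b b' c : is_bipartition n b -> is_bipartition n b' ->
  chi n b.1 b.2 = chi n b'.1 b'.2 -> dominated (component b c) (component b' c).
Proof.
move=> Hb Hb' /irr_inj eq_idx.
have [rowb _] := chi_idxP Hb; have [_ colb'] := chi_idxP Hb'.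
have /cfdot_label[s [fst_s inj_s]] :
    '['Ind[W n] (label_char (@row_label n b.1 b.2) false),
      'Ind[W n] (label_char (@col_label n b'.1 b'.2) true)] != 0.
  rewrite common_constt ?label_Ind_char //; apply/existsP.
  by exists (chi_idx n b.1 b.2); rewrite rowb eq_idx.
exact: (@dominated_of_labels n b b' c s).
Qed.

Lemma chi_inj n b b' : is_bipartition n b -> is_bipartition n b' ->
  chi n b.1 b.2 = chi n b'.1 b'.2 -> b = b'.
Proof.
move=> Hb Hb' eq_chi; have /and3P[p1 p2 _] := Hb; have /and3P[p1' p2' _] := Hb'.
have eq_comp c : is_partition (component b c) -> is_partition (component b' c) ->
    component b c = component b' c.
  by move=> p p'; apply: dominated_anti => //; apply: (@chi_dominated n).
case: b b' {Hb Hb' eq_chi} p1 p2 p1' p2' eq_comp => [x z] [x' z'] /=.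
move=> p1 p2 p1' p2' eq_comp.
by rewrite (eq_comp false p1 p1' : x = x') (eq_comp true p2 p2' : z = z').
Qed.

End LabelledCharacters.

(** * The irreducible components of Omega *)

Section Outer.

Local Open Scope group_scope.
Local Open Scope ring_scope.

Variables (gT rT : finGroupType) (G : {group gT}) (H : {group rT}).
Implicit Types (phi : 'CF(G)) (psi : 'CF(H)).

Lemma cfOuterE phi psi u : cfOuter phi psi u = phi u.1 * psi u.2.
Proof. by rewrite cfunE. Qed.

(** The outer product is the product of the inflations along the two projections.
    The restrictions are to the whole groups, written as images of the product. *)
Lemma cfOuter_char phi psi :
  phi \is a character -> psi \is a character -> cfOuter phi psi \is a character.
Proof.
move=> Nphi Npsi; pose p1 := fst_morphism gT rT; pose p2 := snd_morphism gT rT.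
pose D := setX_group G H.
suff -> : cfOuter phi psi
    = @cfMorph _ _ _ p1 D ('Res[(p1 @* D)%G] phi) *
      @cfMorph _ _ _ p2 D ('Res[(p2 @* D)%G] psi).
  by rewrite rpredM ?cfMorph_char ?cfRes_char.
have im1 : p1 @* D = G by apply: morphim_fstX.
have im2 : p2 @* D = H by apply: morphim_sndX.
apply/cfun_inP => u Du; have := Du; rewrite inE => /andP[G1 H2].
rewrite cfOuterE cfunE !cfMorphE ?subsetT // !cfResE ?im1 ?im2 //.
Qed.

Lemma cfdot_cfOuter phi1 phi2 psi1 psi2 :
  '[cfOuter phi1 psi1, cfOuter phi2 psi2] = '[phi1, phi2] * '[psi1, psi2].
Proof.
rewrite !cfdotE cardsX natrM invfM mulrACA; congr (_ * _).
rewrite mulr_suml; under [RHS]eq_bigr do rewrite mulr_sumr.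
rewrite pair_big_dep /=; apply: eq_big => [u | u _]; first by rewrite inE.
by rewrite !cfOuterE rmorphM mulrACA.
Qed.

End Outer.

Section ThetaComponents.

Local Open Scope group_scope.
Local Open Scope ring_scope.

Lemma sum_seq_neq0 (V : nmodType) (I : eqType) (r : seq I) (P : pred I) (F : I -> V) :
  \sum_(i <- r | P i) F i != 0 -> exists i, [/\ i \in r, P i & F i != 0].
Proof.
move=> sum_neq0; have /hasP[i ir /andP[Pi Fi]] : has (fun i => P i && (F i != 0)) r.
  apply: contraR sum_neq0 => /hasPn noF; rewrite big_seq_cond big1 // => i.
  by case/andP=> /noF; rewrite negb_and => /orP[/negPf-> | /negbNE/eqP].
by exists i.
Qed.

Lemma sum_seq_gt0 (R : numDomainType) (I : eqType) (r : seq I) (P : pred I)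
    (F : I -> R) i :
    (forall j, P j -> 0 <= F j) -> i \in r -> P i -> 0 < F i ->
  0 < \sum_(j <- r | P j) F j.
Proof.
move=> F_ge0 ir Pi Fi; rewrite lt0r sumr_ge0 // andbT psumr_neq0 //.
by apply/hasP; exists i; rewrite ?Pi.
Qed.

Lemma chi_outer_irr l l' b b' :
  exists t, cfOuter (chi l b.1 b.2) (chi l' b'.1 b'.2) = 'chi_t.
Proof.
apply/irrP; rewrite irrEchar cfOuter_char ?irr_char //=.
by rewrite cfdot_cfOuter !cfdot_irr !eqxx mulr1.
Qed.

(** All scalar products of labelled characters are 0 or 1, so that a component
    comes from a term of the sum with the same labels.  The index r of that term,
    which is the size of xi' plus that of zeta, is in range automatically: zeta is
    contained in both b.2 and eta'. *)
Lemma Theta_iff l l' xi' eta' b : is_bipartition l' (xi', eta') ->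
  Theta l l' (xi', eta') b <->
  [/\ is_bipartition l b, b.1 = xi' &
      exists zeta, [/\ is_partition zeta, prec_part zeta b.2 &
                       prec_part zeta eta']].
Proof.
move=> Hb'; rewrite /Theta /irr_component.
have bip x eta j : (sumn x <= j)%N -> is_partition x ->
    eta \in partitions (j - sumn x) -> is_bipartition j (x, eta).
  rewrite mem_partitions => xj px /andP[pe /eqP se].
  by rewrite /is_bipartition /= px pe se subnKC //=.
split=> [[Hb [t tE]] | [Hb b1 [zeta [pz zeta_b zeta_b']]]].
  rewrite irr_consttE -tE /Omega cfdot_suml => /sum_seq_neq0[r [_ _]].
  rewrite cfdot_suml => /sum_seq_neq0[[x z] [/= + _]].
  rewrite mem_bipartitions => /and3P[/= px pz /eqP xz].
  rewrite cfdot_suml => /sum_seq_neq0[eta [eta_part z_eta]].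
  rewrite cfdot_suml => /sum_seq_neq0[eta2 [eta2_part z_eta2]].
  rewrite cfdot_cfOuter mulf_eq0 negb_or !cfdot_irr !pnatr_eq0 !eqb0 !negbK.
  have r_le : (r <= minn l l')%N by rewrite -ltnS ltn_ord.
  case/andP=> /eqP eq_l /eqP eq_l'.
  have Hx : is_bipartition l (x, eta) by apply: bip => //; lia.
  have Hx' : is_bipartition l' (x, eta2) by apply: bip => //; lia.
  have bE := chi_inj Hx Hb (congr1 (fun i => 'chi_i) eq_l).
  have b'E := chi_inj Hx' Hb' (congr1 (fun i => 'chi_i) eq_l').
  by split; [|case: b'E; rewrite -bE|exists z; case: b'E => _ <-; rewrite -bE].
split=> //; have [t tE] := chi_outer_irr l l' b (xi', eta').
exists t => //; rewrite irr_consttE -tE; apply: lt0r_neq0.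
have term_ge0 x eta eta2 : 0 <= '[cfOuter (chi l x eta) (chi l' x eta2),
    cfOuter (chi l b.1 b.2) (chi l' (xi', eta').1 (xi', eta').2)].
  by rewrite cfdot_cfOuter !cfdot_irr mulr_ge0 ?ler0n.
have /and3P[/= pxi peta' /eqP sum_b'] := Hb'.
have /and3P[/= _ peta /eqP sum_b] := Hb; rewrite b1 in sum_b.
have r_lt : (sumn xi' + sumn zeta < (minn l l').+1)%N.
  by have := prec_part_sumn zeta_b; have := prec_part_sumn zeta_b'; lia.
rewrite /Omega cfdot_suml.
apply: (@sum_seq_gt0 _ _ _ _ _ (Ordinal r_lt)); rewrite ?mem_index_enum //.
  move=> r _.
  rewrite cfdot_suml sumr_ge0 // => xz _; rewrite cfdot_suml sumr_ge0 // => eta _.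
  by rewrite cfdot_suml sumr_ge0.
rewrite cfdot_suml; apply: (@sum_seq_gt0 _ _ _ _ _ (xi', zeta)) => // [xz _||].
- rewrite cfdot_suml sumr_ge0 // => eta _.
  by rewrite cfdot_suml sumr_ge0.
- by rewrite mem_bipartitions /is_bipartition /= pxi pz eqxx.
rewrite cfdot_suml; apply: (@sum_seq_gt0 _ _ _ _ _ b.2) => // [eta _||].
- by rewrite cfdot_suml sumr_ge0.
- by rewrite mem_partitions /is_partition_of peta -sum_b addKn /=.
rewrite cfdot_suml; apply: (@sum_seq_gt0 _ _ _ _ _ eta') => //=.
  by rewrite mem_partitions /is_partition_of peta' -sum_b' addKn /=.
by rewrite cfdot_cfOuter !cfdot_irr b1 !eqxx mulr1 ltr01.
Qed.

End ThetaComponents.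

(** * The extremal representations *)

Lemma Theta_lambda_mono l l' xi' eta' c d : is_bipartition l' (xi', eta') ->
    Theta l l' (xi', eta') c -> Theta l l' (xi', eta') d ->
  dominated c.2 d.2 -> dominated (lambda c) (lambda d).
Proof.
move=> Hb' /(Theta_iff _ _ Hb')[Hc xc _] /(Theta_iff _ _ Hb')[Hd xd _].
case: c d xc xd Hc Hd => [x e] [x' f] /= -> -> Hc Hd; exact: lambda_mono Hc Hd.
Qed.

Lemma Theta_lambda_anti l l' xi' eta' c d : is_bipartition l' (xi', eta') ->
    Theta l l' (xi', eta') c -> Theta l l' (xi', eta') d ->
  dominated (lambda c) (lambda d) -> dominated (lambda d) (lambda c) -> c = d.
Proof.
move=> Hb' /(Theta_iff _ _ Hb')[Hc xc _] /(Theta_iff _ _ Hb')[Hd xd _].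
case: c d xc xd Hc Hd => [x e] [x' f] /= -> -> Hc Hd cd dc; congr (_, _).
have /andP[pc _] := lambda_partition Hc; have /andP[pd _] := lambda_partition Hd.
exact: lambda_inj Hc Hd (dominated_anti pc pd cd dc).
Qed.

Lemma unique_minimal_rep l l' xi' eta' b : is_bipartition l' (xi', eta') ->
    Theta l l' (xi', eta') b ->
    (forall c, Theta l l' (xi', eta') c -> dominated b.2 c.2) ->
  unique (minimal_rep l l' (xi', eta')) b.
Proof.
move=> Hb' Tb min_b; have lam_b c Tc := Theta_lambda_mono Hb' Tb Tc (min_b c Tc).
split=> // c [Tc min_c].
exact: Theta_lambda_anti Hb' Tb Tc (lam_b c Tc) (min_c b Tb).
Qed.

Lemma unique_maximal_rep l l' xi' eta' b : is_bipartition l' (xi', eta') ->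
    Theta l l' (xi', eta') b ->
    (forall c, Theta l l' (xi', eta') c -> dominated c.2 b.2) ->
  unique (maximal_rep l l' (xi', eta')) b.
Proof.
move=> Hb' Tb max_b; have lam_b c Tc := Theta_lambda_mono Hb' Tc Tb (max_b c Tc).
split=> // c [Tc max_c].
exact: Theta_lambda_anti Hb' Tb Tc (max_c b Tb) (lam_b c Tc).
Qed.

Theorem theorem7 (k m m' : nat) (xi' eta' : seq nat)
    (hmm' : 2 * m' <= m) (hm : k * k.+1 <= m) (hm' : k ^ 2 <= m')
    (l := m - k * k.+1) (l' := m' - k ^ 2)
    (hb' : is_bipartition l' (xi', eta')) :
  unique (minimal_rep l l' (xi', eta'))
         (xi', adjoin (l - l') eta') /\
  unique (maximal_rep l l' (xi', eta'))
         (xi', strip (l - l' + nth 0 eta' 0 + nth 0 eta' 1 :: drop 2 eta')).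
Proof.
have le_l : l' <= l - l'.
  have : k <= k ^ 2 by case: (k) => // j; rewrite -mulnn leq_pmulr.
  by rewrite /l /l'; move: hmm' hm hm'; rewrite mulnS -mulnn; lia.
have /and3P[pxi peta /eqP sum_b'] := hb'; rewrite /= in pxi peta sum_b'.
have /andP[seta eta0] := peta.
have noninc := sorted_geq_nth seta.
have head_le : nth 0 eta' 0 <= l - l'.
  apply: leq_trans le_l; rewrite -sum_b'; case: (eta') => //= a s; lia.
pose emin := l - l' :: eta'.
have smin : sorted geq emin.
  by apply: sorted_geq_of_nth => -[|i] //=; apply: noninc.
have -> : adjoin (l - l') eta' = strip emin.
  rewrite /adjoin; congr strip; apply: sorted_sort smin => //.
  by move=> b a c ba cb; apply: leq_trans cb ba.
pose emax := l - l' + nth 0 eta' 0 + nth 0 eta' 1 :: drop 2 eta'.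
have emaxS i : nth 0 emax i.+1 = nth 0 eta' i.+2 by rewrite /= nth_drop.
have smax : sorted geq emax.
  apply: sorted_geq_of_nth => -[|i]; rewrite !emaxS; last exact: noninc.
  by have := noninc 1 2 isT => /=; lia.
have sum_emax : sumn emax = l - l' + sumn eta'.
  by rewrite /emax; case: (eta') => [|a [|b s]] /=; rewrite ?drop0; lia.
have part e : sorted geq e -> sumn e = l - l' + sumn eta' ->
    is_bipartition l (xi', strip e).
  move=> se sum_e; rewrite /is_bipartition /= pxi is_partition_strip //=.
  by rewrite sumn_strip sum_e; lia.
have ThetaP c : Theta l l' (xi', eta') c ->
    sumn c.2 = l - l' + sumn eta' /\
    forall i, nth 0 c.2 i.+1 <= nth 0 eta' i /\ nth 0 eta' i.+1 <= nth 0 c.2 i.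
  case/(Theta_iff _ _ hb')=> /and3P[_ _ /eqP sum_c] c1.
  case=> zeta [_ /prec_partP zc /prec_partP ze].
  split; first by move: sum_c; rewrite c1; lia.
  by move=> i; have := zc i; have := ze i; lia.
split.
  apply: unique_minimal_rep => //.
    apply/(Theta_iff _ _ hb'); split=> //; first exact: part.
    (* Adjoining a first part shifts eta' by one place. *)
    exists eta'; split=> //; apply/prec_partP => i; last by rewrite leqnn noninc.
    rewrite ![nth 0 (_, _).2 _]nth_strip // leqnn.
    exact: (sorted_geq_nth smin (leqnSn i)).
  move=> c /ThetaP[sum_c c_le]; apply: dominated_of_tail => [|i].
    by rewrite sumn_strip sum_c.
  by rewrite [nth 0 (_, _).2 _]nth_strip //; have [] := c_le i.
apply: unique_maximal_rep => //.
  apply/(Theta_iff _ _ hb'); split=> //; first exact: part.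
  (* The parts of eta' of index at least 1 have to be kept by zeta, and the first
     two may be merged with the surplus. *)
  exists (behead eta'); split.
  - move: peta; rewrite /is_partition; case: (eta') => //= a s.
    by rewrite inE negb_or => /andP[/path_sorted-> /andP[_ ->]].
  - apply/prec_partP => i; rewrite ![nth 0 (_, _).2 _]nth_strip //.
    rewrite nth_behead emaxS noninc //=.
    by case: i => [|i]; rewrite ?emaxS //= leq_addl.
  by apply/prec_partP => i; rewrite nth_behead leqnn noninc.
move=> c /ThetaP[sum_c c_le]; apply: dominated_of_tail => [|i].
  by rewrite sumn_strip sum_c.
by rewrite [nth 0 (_, _).2 _]nth_strip // emaxS; have [] := c_le i.+1.
Qed.
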